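(* Let $X_{n,k}^{P}$ be the number of subtrees of size $k$ with some given property $P$ in the random binary search tree $\mathcal{T}_n$, and let $\hat X_{n,k}^{P}$ be the number of subtrees of size $k$ with some given property $P$ in the random recursive tree $\Lambda_n$. Let $p_{k,P}:=\mathbb{P}(\mathcal{T}_k\in P)$ and $\hat p_{k,P}:=\mathbb{P}(\Lambda_k\in P)$ be the probabilities that a random binary search tree, respectively a random recursive tree, of size $k$ has property $P$. Let $k=k_n$ where $1\le k<n$, and let $\mu_{n,k}^{P}:=\mathbb{E}(X_{n,k}^{P})$ and $\hat\mu_{n,k}^{P}:=\mathbb{E}(\hat X_{n,k}^{P})$. Then $$\mu_{n,k}^{P}=\frac{2(n+1)p_{k,P}}{(k+1)(k+2)},\qquad \hat\mu_{n,k}^{P}=\frac{n\,\hat p_{k,P}}{k(k+1)}.$$ For the binary search tree, if $k\ne (n-1)/2$, $$d_{TV}\bigl(\mathcal{L}(X_{n,k}^{P}),\mathrm{Po}(\mu_{n,k}^{P})\bigr)=\frac12\sum_{l\ge0}\Bigl|\mathbb{P}(X_{n,k}^{P}=l)-e^{-\mu_{n,k}^{P}}\frac{(\mu_{n,k}^{P})^l}{l!}\Bigr|=\begin{cases}O\bigl(\frac{p_{k,P}}{k}\bigr)&\text{if }\mu_{n,k}^{P}\ge1,\\ O\bigl(\frac{p_{k,P}}{k}\cdot\mu_{n,k}^{P}\bigr)&\text{if }\mu_{n,k}^{P}<1,\end{cases}$$ and if $k=(n-1)/2$, $$d_{TV}\bigl(\mathcal{L}(X_{n,k}^{P}),\mathrm{Po}(\mu_{n,k}^{P})\bigr)=O\Bigl(\frac{p_{k,P}^2}{k}\Bigr).$$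 For the random recursive tree, $$d_{TV}\bigl(\mathcal{L}(\hat X_{n,k}^{P}),\mathrm{Po}(\hat\mu_{n,k}^{P})\bigr)=\frac12\sum_{l\ge0}\Bigl|\mathbb{P}(\hat X_{n,k}^{P}=l)-e^{-\hat\mu_{n,k}^{P}}\frac{(\hat\mu_{n,k}^{P})^l}{l!}\Bigr|=\begin{cases}O\bigl(\frac{\hat p_{k,P}}{k}\bigr)&\text{if }\hat\mu_{n,k}^{P}\ge1,\\ O\bigl(\frac{\hat p_{k,P}}{k}\cdot\hat\mu_{n,k}^{P}\bigr)&\text{if }\hat\mu_{n,k}^{P}<1.\end{cases}$$ Consequently, if $n\to\infty$ and $k\to\infty$, then $d_{TV}(\mathcal{L}(X_{n,k}^{P}),\mathrm{Po}(\mu_{n,k}^{P}))\to0$ and $d_{TV}(\mathcal{L}(\hat X_{n,k}^{P}),\mathrm{Po}(\hat\mu_{n,k}^{P}))\to0$.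
   Context: Random binary search tree $\mathcal{T}_n$: insert the keys of a uniformly random permutation of $\{1,\dots,n\}$ one by one; the first key is placed at the root, and each later key starts at the root and at each occupied node proceeds to the left child position if it is smaller than the key there and to the right child position if it is larger, until it reaches an empty position, where it is placed. It is regarded as an unlabelled binary tree (each node has possibly a left child and possibly a right child, which are distinguished). Random recursive tree $\Lambda_n$: start with a root labelled $1$; for $i=2,\dots,n$, node $i$ is attached as a child of a uniformly random node among $1,\dots,i-1$ (independently of earlier choices). It is regarded as an ordered rooted tree by ordering the children of each node by increasing labels from left to right and then ignoring the labels. The size of a tree is its number of nodes. A subtree always means a fringe subtree: a node together with all its descendants. In the binary search tree case a property $P$ is any set of binary trees; in the random recursive tree case it is any set of ordered rooted trees. $\mathcal{L}(X)$ is the distribution of $X$, $\mathrm{Po}(\mu)$ the Poisson distribution with mean $\mu$, and $d_{TV}(\mu_1,\mu_2):=\sup_A|\mu_1(A)-\mu_2(A)|$ over measurable sets $A$. The constants implied by $O$ are absolute (uniform in $n$, $k$ and $P$). *)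

(* Defs.v *)
From HB Require Import structures.
From mathcomp Require Import all_boot all_order all_algebra all_fingroup.
From mathcomp Require Import all_classical all_reals all_analysis.

Set Implicit Arguments.
Unset Strict Implicit.
Unset Printing Implicit Defensive.

Import Order.TTheory GRing.Theory Num.Theory.
Import numFieldNormedType.Exports.

Local Open Scope classical_set_scope.
Local Open Scope ring_scope.

(* [discr t0] is the nonempty finite type T with the sigma-algebra of all its
   subsets. Measurable types have to be pointed, hence the element t0. *)
Definition discr (T : finType) (t0 : T) : Type := T.

Section Discrete.
Variables (T : finType) (t0 : T).

HB.instance Definition _ := Finite.copy (discr t0) T.
HB.instance Definition _ := isPointed.Build (discr t0) t0.

HB.instance Definition _ := @isMeasurable.Build default_measure_display
  (discr t0) (@discrete_measurable (discr t0))
  (@discrete_measurable0 (discr t0)) (@discrete_measurableC (discr t0))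
  (@discrete_measurableU (discr t0)).

End Discrete.

Definition uniform_fin (R : realType) (T : finType) (t0 : T)
    (A : set (discr t0)) : \bar R :=
  (#|[pred x : T | `[< A x >]]|%:R / #|T|%:R)%:E.

Section UniformFin.
Local Open Scope ereal_scope.
Variables (R : realType) (T : finType) (t0 : T).

Local Notation unif := (@uniform_fin R T t0).

Let c_ge0 : (0 <= (#|T|%:R : R)^-1)%R.
Proof. by rewrite invr_ge0 ler0n. Qed.

Let m (i : nat) : {measure set (discr t0) -> \bar R} :=
  if insub i is Some j then \d_(enum_val (j : 'I_#|T|) : discr t0) else mzero.

Let unifE (A : set (discr t0)) : unif A =
  mscale (NngNum c_ge0) (msum m #|T|) A.
Proof.
rewrite /mscale/= /msum /uniform_fin.
rewrite (eq_bigr (fun k : 'I_#|T| =>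
    ((`[< A (enum_val k) >] : nat)%:R : R)%:E)); last first.
  move=> k _; rewrite /m valK /= diracE.
  by case: asboolP => Ak; [rewrite mem_set | rewrite memNset].
rewrite sumEFin -EFinM mulrC; congr ((_ * _)%:E)%R.
rewrite -natr_sum; congr (_%:R).
transitivity (\sum_(x in T) (`[< A x >] : nat))%N.
  by rewrite -sum1_card big_mkcond; apply: eq_bigr => x _; rewrite inE;
    case: asboolP.
exact: big_enum_val.
Qed.

Let unif0 : unif set0 = 0.
Proof. by rewrite unifE measure0. Qed.

Let unif_ge0 A : 0 <= unif A.
Proof. by rewrite unifE. Qed.

Let unif_sigma_additive : semi_sigma_additive unif.
Proof.
have -> : unif = mscale (NngNum c_ge0) (msum m #|T|).
  by apply/funext => A; exact: unifE.
exact: measure_semi_sigma_additive.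
Qed.

HB.instance Definition _ := isMeasure.Build _ _ _ unif
  unif0 unif_ge0 unif_sigma_additive.

Let unif_setT : unif [set: discr t0] = 1.
Proof.
rewrite /uniform_fin (_ : #|_| = #|T|); last first.
  by apply: eq_card => x; rewrite !inE; apply/asboolP.
by rewrite divff// pnatr_eq0 -lt0n; apply/card_gt0P; exists t0.
Qed.

HB.instance Definition _ :=
  @Measure_isProbability.Build _ _ R unif unif_setT.

End UniformFin.

Definition dTV d (T : measurableType d) (R : realType) (m1 m2 : probability T R)
    : \bar R :=
  ereal_sup [set `|m1 A - m2 A|%E | A in measurable].

(* The second argument of [poisson_prob] is not used; [Po R 0] is the Dirac
   measure at 0. *)
Definition Po (R : realType) (mu : R) : probability nat R := poisson_prob mu 0%N.

(* Binary trees are labelled by keys during the construction; an unlabelled one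
   has labels in [unit]. *)
Inductive bintree (A : Type) : Type :=
| BEmpty
| BNode of bintree A & A & bintree A.

Fixpoint bst_insert (x : nat) (t : bintree nat) : bintree nat :=
  match t with
  | BEmpty => BNode (BEmpty nat) x (BEmpty nat)
  | BNode l y r => if (x < y)%N then BNode (bst_insert x l) y r
                   else BNode l y (bst_insert x r)
  end.

Fixpoint bin_shape (t : bintree nat) : bintree unit :=
  match t with
  | BEmpty => BEmpty unit
  | BNode l _ r => BNode (bin_shape l) tt (bin_shape r)
  end.

Fixpoint bin_size (t : bintree unit) : nat :=
  match t with
  | BEmpty => 0
  | BNode l _ r => (bin_size l + bin_size r).+1
  end.

(* One entry for each node, with repetitions. *)
Fixpoint bin_subtrees (t : bintree unit) : seq (bintree unit) :=
  match t with
  | BEmpty => [::]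
  | BNode l _ r => t :: bin_subtrees l ++ bin_subtrees r
  end.

Definition bst_space n := discr (1%g : 'S_n).

Definition bst_prob (R : realType) n : probability (bst_space n) R :=
  @uniform_fin R _ (1%g : 'S_n).

(* The keys s(0)+1, ..., s(n-1)+1 form a permutation of 1, ..., n. *)
Definition bst n (s : bst_space n) : bintree unit :=
  bin_shape (foldl (fun t x => bst_insert x t) (BEmpty nat)
    [seq ((s : 'S_n) i).+1 | i <- enum 'I_n]).

Definition bst_count n k (P : set (bintree unit)) (s : bst_space n) : nat :=
  count (fun t => (bin_size t == k) && `[< P t >]) (bin_subtrees (bst s)).

HB.instance Definition _ n k P := @isMeasurableFun.Build _ _ (bst_space n) nat
  (@bst_count n k P) (fun _ _ _ => I).

Definition bst_p (R : realType) k (P : set (bintree unit)) : R :=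
  fine (bst_prob R k [set s | P (bst s)]).

Definition bst_mean (R : realType) n k (P : set (bintree unit)) : R :=
  fine 'E_(bst_prob R n)[fun s => (bst_count k P s)%:R].

(* Children are listed from left to right. *)
Inductive otree (A : Type) : Type := ONode of A & seq (otree A).

(* Attach a new node labelled i as the last child of the node labelled j. As
   nodes arrive with increasing labels, the children of every node stay ordered
   by increasing labels. *)
Fixpoint attach (i j : nat) (t : otree nat) : otree nat :=
  let: ONode x ts := t in
  let ts' := map (attach i j) ts in
  ONode x (if x == j then rcons ts' (ONode i [::]) else ts').

Fixpoint otree_shape (t : otree nat) : otree unit :=
  let: ONode _ ts := t in ONode tt (map otree_shape ts).

Fixpoint otree_size (t : otree unit) : nat :=
  let: ONode _ ts := t in (sumn (map otree_size ts)).+1.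

Fixpoint otree_subtrees (t : otree unit) : seq (otree unit) :=
  let: ONode _ ts := t in t :: flatten (map otree_subtrees ts).

(* For i = 0, ..., n-2, the coordinate i chooses the parent f(i)+1 of the node
   i+2 among the nodes 1, ..., i+1. Under the uniform probability on this
   product, the choices are independent and each one is uniform. *)
Definition rrt_choice n := {dffun forall i : 'I_n.-1, 'I_i.+1}.

Definition rrt_choice0 n : rrt_choice n := [ffun i : 'I_n.-1 => ord0 : 'I_i.+1].

Definition rrt_space n := discr (rrt_choice0 n).

Definition rrt_prob (R : realType) n : probability (rrt_space n) R :=
  @uniform_fin R _ (rrt_choice0 n).

Definition rrt n (f : rrt_space n) : otree unit :=
  otree_shape (foldl
    (fun t (i : 'I_n.-1) => attach i.+2 ((f : rrt_choice n) i).+1 t)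
    (ONode 1%N [::]) (enum 'I_n.-1)).

Definition rrt_count n k (P : set (otree unit)) (f : rrt_space n)
    : nat :=
  count (fun t => (otree_size t == k) && `[< P t >]) (otree_subtrees (rrt f)).

HB.instance Definition _ n k P :=
  @isMeasurableFun.Build _ _ (rrt_space n) nat
    (@rrt_count n k P) (fun _ _ _ => I).

Definition rrt_p (R : realType) k (P : set (otree unit)) : R :=
  fine (rrt_prob R k [set f | P (rrt f)]).

Definition rrt_mean (R : realType) n k (P : set (otree unit)) : R :=
  fine 'E_(rrt_prob R n)[fun f => (rrt_count k P f)%:R].

(* Main.v *)
Require Import Defs.
From mathcomp Require Import all_boot all_order all_algebra all_fingroup.
From mathcomp Require Import all_classical all_reals all_analysis.
From mathcomp Require Import zify ring lra.

Set Implicit Arguments.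
Unset Strict Implicit.
Unset Printing Implicit Defensive.

Import Order.TTheory GRing.Theory Num.Theory.
Import numFieldNormedType.Exports.

(** Give every node of a random tree the time at which it arrives. Both trees are
    then read off from a uniformly random sequence of time stamps. The binary
    search tree is the Cartesian tree of the sequence that lists the insertion
    times in the order of the keys ([bst_perm_shape]). A recursive tree becomes,
    under the rotation correspondence, the Cartesian tree of its non-root labels
    in preorder with the youngest children first, and these labels form a
    uniform permutation because a new node is placed directly after its parent
    ([rrt_perm_bij]).

    In a Cartesian tree a block of [b] consecutive positions carries a fringe
    subtree exactly when both of its neighbours are smaller than everything in
    the block, and the subtree is a right one when the left neighbour is the
    larger of the two ([count_windows]). Adding one position with the smallest
    time stamp closes the sequence to a cycle; rotating the cycle does not change
    the number of such windows, so all orders of the cycle may be taken equally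
    likely ([avg_cyc_count]). The count is now a sum of [m.+1] indicators with
    the same probability, [b] being [k] and [m.+1] being [n.+1] for binary search
    trees, and [k.-1] and [n] for recursive trees, whose subtrees of size [k]
    correspond to the right subtrees of size [k.-1].

    A window depends only on the relative order of its [b.+2] positions, hence it
    is independent of all windows disjoint from it. Its probability is computed
    by asking which position is smallest and using exchangeability
    ([avg_window]): it is the probability of the property for a uniform block
    times [2 / ((b + 1) * (b + 2))], or half of that for right subtrees. This
    gives the means. Of the windows that meet a given one, only the two that
    share a boundary position with it can occur together with it, and this has
    probability of order [p ^ 2 / (b + 1) ^ 3] ([avg_window_pair]). The exception is
    the cycle of [2 * b + 2] positions, where two windows share both boundaries
    and the order is [p ^ 2 / (b + 1) ^ 2] ([avg_window_pair_tight]); this is the case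
    [n = 2 * k + 1] for binary search trees, and for recursive trees such pairs
    do not exist.

    The local form of the Chen-Stein method ([chen_stein]) converts the
    independence and these two probabilities into a bound for the total variation
    distance, with the factor [min 1 mu^-1] that bounds the increments of the
    solution of Stein's equation ([stein_solution_lip]). The sum of the error
    terms is of order [mu * p / k], or [p ^ 2 / k] in the exceptional case, which
    is the assertion. As [p <= 1], all bounds are at most a constant times
    [k^-1], and the limit statement follows. *)

(** * Cartesian trees *)

Fixpoint inorder (A : Type) (t : bintree A) : seq A :=
  match t with
  | BEmpty => [::]
  | BNode l x r => inorder l ++ x :: inorder r
  end.

Fixpoint bin_map (A B : Type) (g : A -> B) (t : bintree A) : bintree B :=
  match t with
  | BEmpty => BEmpty B
  | BNode l x r => BNode (bin_map g l) (g x) (bin_map g r)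
  end.

Fixpoint cartesian_cons (v : nat -> nat) (x : nat) (t : bintree nat) :=
  match t with
  | BEmpty => BNode (BEmpty nat) x (BEmpty nat)
  | BNode l y r => if (v x < v y)%N then BNode (BEmpty nat) x t
                   else BNode (cartesian_cons v x l) y r
  end.

(** The tree with inorder sequence [w] whose labels have values under [v]
    increasing away from the root. Building it from the right end of [w] keeps
    the definition structural: the new first entry enters the left spine. *)
Definition cartesian (v : nat -> nat) (w : seq nat) : bintree nat :=
  foldr (cartesian_cons v) (BEmpty nat) w.

Lemma inorder_cartesian_cons v x t :
  inorder (cartesian_cons v x t) = x :: inorder t.
Proof.
elim: t => [|l IHl y r _] //=.
by case: ifP => _ //=; rewrite IHl.
Qed.

Lemma inorder_cartesian v w : inorder (cartesian v w) = w.
Proof. by elim: w => //= x w IHw; rewrite inorder_cartesian_cons IHw. Qed.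

Lemma cartesian_cat v u m w :
  all (fun x => v m < v x)%N (u ++ w) ->
  cartesian v (u ++ m :: w) = BNode (cartesian v u) m (cartesian v w).
Proof.
rewrite all_cat => /andP[mu mw]; elim: u mu => [_|x u IHu /= /andP[mx mu]] /=.
  have := inorder_cartesian v w.
  case: (cartesian v w) => [|l y r] //= Ew.
  suff -> : (v m < v y)%N by [].
  by move/allP: mw => -> //; rewrite -Ew mem_cat mem_head orbT.
by rewrite IHu //= ltnNge ltnW.
Qed.

Lemma cartesian_map v v' (g : nat -> nat) w :
  {in w &, forall x y, (v' (g x) < v' (g y))%N = (v x < v y)%N} ->
  cartesian v' (map g w) = bin_map g (cartesian v w).
Proof.
have step x t : (forall y, y \in inorder t ->
      (v' (g x) < v' (g y))%N = (v x < v y)%N) ->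
    cartesian_cons v' (g x) (bin_map g t) = bin_map g (cartesian_cons v x t).
  elim: t => [|l IHl y r _] //= Ht.
  rewrite Ht ?mem_cat ?mem_head ?orbT//; case: ifP => //= _.
  by rewrite IHl// => z zl; rewrite Ht// mem_cat zl.
elim: w => //= x w IHw Hw; rewrite IHw; last first.
  by move=> y z yw zw; rewrite Hw// inE ?yw ?zw orbT.
rewrite step// => y; rewrite inorder_cartesian => yw.
by rewrite Hw ?mem_head// inE yw orbT.
Qed.

Lemma bin_shape_map (g : nat -> nat) t : bin_shape (bin_map g t) = bin_shape t.
Proof. by elim: t => //= l -> x r ->. Qed.

Lemma bin_size_shape t : bin_size (bin_shape t) = size (inorder t).
Proof. by elim: t => //= l -> x r ->; rewrite size_cat /= addnS. Qed.

Fixpoint heap (v : nat -> nat) (t : bintree nat) : bool :=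
  match t with
  | BEmpty => true
  | BNode l y r => [&& all (fun x => v y < v x)%N (inorder l ++ inorder r),
                       heap v l & heap v r]
  end.

(** Heap order and the inorder sequence determine a tree. This identifies both
    trees grown at random as Cartesian trees: in each of them a new node has a
    larger time stamp than all its ancestors. *)
Lemma heap_cartesian v t : heap v t -> cartesian v (inorder t) = t.
Proof.
elim: t => //= l IHl y r IHr /and3P[lr hl hr].
by rewrite cartesian_cat// IHl// IHr.
Qed.

(** * Binary search trees as Cartesian trees *)

Lemma perm_inorder_bst_insert x t :
  perm_eq (inorder (bst_insert x t)) (x :: inorder t).
Proof.
elim: t => //= l IHl y r IHr; case: ifP => _ /=.
  by rewrite -cat_cons perm_cat2r.
rewrite -[x :: _]cat1s perm_sym perm_catCA perm_cat2l.
by rewrite (perm_catCA [:: x] [:: y]) /= perm_cons perm_sym.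
Qed.

Lemma perm_inorder_bst w :
  perm_eq (inorder (foldl (fun t x => bst_insert x t) (BEmpty nat) w)) w.
Proof.
elim/last_ind: w => //= w x IHw; rewrite foldl_rcons.
rewrite (permPl (perm_inorder_bst_insert _ _)) perm_sym perm_rcons perm_cons.
by rewrite perm_sym.
Qed.

Lemma sorted_inorder_bst_insert x t :
  x \notin inorder t -> pairwise ltn (inorder t) ->
  pairwise ltn (inorder (bst_insert x t)).
Proof.
elim: t => //= l IHl y r IHr.
rewrite mem_cat inE !negb_or => /and3P[xl xy xr].
rewrite pairwise_cat /= allrel_consr => /and3P[/andP[ly lr] pl /andP[yr pr]].
case: ifP => [ltxy|/negbT]; rewrite /= pairwise_cat /= allrel_consr.
  have all_ins (p : pred nat) :
      all p (inorder (bst_insert x l)) = p x && all p (inorder l).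
    by rewrite (perm_all _ (perm_inorder_bst_insert x l)).
  rewrite yr pr IHl// all_ins ly /= ltxy /= !andbT.
  rewrite /allrel all_ins; apply/andP; split=> //.
  by apply: sub_all yr => z /=; apply: ltn_trans.
rewrite -leqNgt leq_eqVlt eq_sym (negPf xy) /= => ltyx.
have all_ins (p : pred nat) :
    all p (inorder (bst_insert x r)) = p x && all p (inorder r).
  by rewrite (perm_all _ (perm_inorder_bst_insert x r)).
rewrite ly pl IHr// all_ins yr /= ltyx /= !andbT.
apply/allrelP => a b al; rewrite (perm_mem (perm_inorder_bst_insert x r)) inE.
case/predU1P => [->|br]; last by move/allrelP: lr => /(_ a b al br).
by move/allP: ly => /(_ a al) /= /ltn_trans; apply.
Qed.

Lemma sorted_inorder_bst w : uniq w ->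
  pairwise ltn (inorder (foldl (fun t x => bst_insert x t) (BEmpty nat) w)).
Proof.
elim/last_ind: w => //= w x IHw; rewrite rcons_uniq => /andP[xw uw].
rewrite foldl_rcons; apply: sorted_inorder_bst_insert; last exact: IHw.
by rewrite (perm_mem (perm_inorder_bst w)).
Qed.

Lemma heap_bst_insert v x t :
  {in inorder t, forall y, v y < v x}%N -> heap v t -> heap v (bst_insert x t).
Proof.
elim: t => //= l IHl y r IHr xt /and3P[].
rewrite all_cat => /andP[yl yr] hl hr.
have [xl xr] : {in inorder l, forall y, v y < v x}%N /\
    {in inorder r, forall y, v y < v x}%N.
  by split=> z zt; apply: xt; rewrite mem_cat inE zt ?orbT.
have yx : (v y < v x)%N by apply: xt; rewrite mem_cat mem_head orbT.
case: ifP => _ /=; rewrite all_cat (perm_all _ (perm_inorder_bst_insert _ _)) /=.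
  by rewrite yx yl yr hr IHl.
by rewrite yx yl yr hl IHr.
Qed.

Lemma heap_bst w : uniq w ->
  heap (index^~ w) (foldl (fun t x => bst_insert x t) (BEmpty nat) w).
Proof.
move=> uw; suff gen u z : w = u ++ z ->
    heap (index^~ w) (foldl (fun t x => bst_insert x t) (BEmpty nat) u).
  by apply: (gen w [::]); rewrite cats0.
elim/last_ind: u z => //= u x IHu z; rewrite cat_rcons => Ew.
rewrite foldl_rcons; apply: heap_bst_insert; last exact: (IHu (x :: z)).
move=> y; rewrite (perm_mem (perm_inorder_bst u)) => yu.
rewrite Ew !index_cat yu; move: uw; rewrite Ew cat_uniq => /and3P[_ ux _].
rewrite ifN; last by apply: contra ux => xu; apply/hasP; exists x => //;
  rewrite mem_head.
by rewrite (leq_trans _ (leq_addr _ _))// index_mem.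
Qed.

Lemma bst_cartesian m n w : perm_eq w (iota m n) ->
  foldl (fun t x => bst_insert x t) (BEmpty nat) w =
  cartesian (index^~ w) (iota m n).
Proof.
move=> pw; have uw : uniq w by rewrite (perm_uniq pw) iota_uniq.
rewrite -[LHS](heap_cartesian (heap_bst uw)); congr cartesian.
apply: (sorted_eq ltn_trans).
- by move=> x y /=; lia.
- by rewrite sorted_pairwise; [exact: sorted_inorder_bst|exact: ltn_trans].
- exact: iota_ltn_sorted.
- exact: perm_trans (perm_inorder_bst w) pw.
Qed.

(** * Recursive trees under the rotation correspondence *)

(** The rotation correspondence between binary trees and forests: a node
    becomes the oldest root, its right subtree the forest of its descendants
    and its left subtree the forest of the younger roots. The subtree of the
    forest at a node is then read off from the right subtree at that node. *)
Fixpoint forest (A : Type) (t : bintree A) : seq (otree A) :=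
  match t with
  | BEmpty => [::]
  | BNode l x r => ONode x (forest r) :: forest l
  end.

Fixpoint add_leftmost (x : nat) (t : bintree nat) : bintree nat :=
  match t with
  | BEmpty => BNode (BEmpty nat) x (BEmpty nat)
  | BNode l y r => BNode (add_leftmost x l) y r
  end.

Fixpoint bin_attach (i j : nat) (t : bintree nat) : bintree nat :=
  match t with
  | BEmpty => BEmpty nat
  | BNode l x r =>
      BNode (bin_attach i j l) x
        (if x == j then add_leftmost i (bin_attach i j r)
         else bin_attach i j r)
  end.

Definition insert_after (i j : nat) (w : seq nat) : seq nat :=
  flatten [seq if x == j then [:: x; i] else [:: x] | x <- w].

Lemma forest_add_leftmost x t :
  forest (add_leftmost x t) = rcons (forest t) (ONode x [::]).
Proof. by elim: t => //= l -> y r _. Qed.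

Lemma inorder_add_leftmost x t : inorder (add_leftmost x t) = x :: inorder t.
Proof. by elim: t => //= l -> y r _. Qed.

Lemma forest_attach i j t :
  map (attach i j) (forest t) = forest (bin_attach i j t).
Proof.
elim: t => //= l -> x r ->; congr (ONode _ _ :: _).
by case: ifP => // _; rewrite forest_add_leftmost.
Qed.

Lemma inorder_bin_attach i j t :
  inorder (bin_attach i j t) = insert_after i j (inorder t).
Proof.
rewrite /insert_after; elim: t => //= l -> x r IHr.
rewrite map_cat flatten_cat /=; congr cat.
by case: ifP => _ /=; rewrite ?inorder_add_leftmost IHr.
Qed.

Lemma mem_insert_after i j w x :
  x \in insert_after i j w -> (x == i) || (x \in w).
Proof.
case/flatten_mapP => y yw; case: ifP => _; rewrite !inE.
  by case/orP => /eqP ->; rewrite ?eqxx// yw orbT.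
by move=> /eqP ->; rewrite yw orbT.
Qed.

Lemma heap_bin_attach i j t :
  {in inorder t, forall x, x < i}%N -> heap id t -> heap id (bin_attach i j t).
Proof.
elim: t => //= l IHl x r IHr ti /and3P[].
rewrite all_cat => /andP[xl xr] hl hr.
have xi : (x < i)%N by apply: ti; rewrite mem_cat mem_head orbT.
have [li ri] : {in inorder l, forall y, y < i}%N /\
    {in inorder r, forall y, y < i}%N.
  by split=> z zt; apply: ti; rewrite mem_cat inE zt ?orbT.
have stable s : all (fun y => x < y)%N s ->
    all (fun y => x < y)%N (insert_after i j s).
  by move=> /allP xs; apply/allP => y /mem_insert_after/predU1P[->|/xs].
have hadd_att s : {in inorder s, forall y, y < i}%N -> heap id (bin_attach i j s) ->
    heap id (add_leftmost i (bin_attach i j s)).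
  elim: s => [|s1 IH1 y s2 _] //= si /and3P[].
  rewrite !all_cat inorder_add_leftmost /= => /andP[-> ->] h1 ->.
  rewrite IH1// ?andbT; last by move=> z zs; apply: si; rewrite mem_cat zs.
  by apply: si; rewrite mem_cat mem_head orbT.
have hl' := IHl li hl; have hr' := IHr ri hr.
case: ifP => _; rewrite ?inorder_add_leftmost all_cat /= !inorder_bin_attach.
  by rewrite !stable// xi hl' hadd_att.
by rewrite !stable// hl' hr'.
Qed.

(** Preorder of a recursive tree with the children of each node taken from the
    youngest to the oldest: a new node appears directly after its parent. *)
Definition rrt_word (f : nat -> nat) (m : nat) : seq nat :=
  foldl (fun w i => insert_after i.+2 (f i).+1 w) [:: 1%N] (iota 0 m).

Lemma iota_rcons m n : iota m n.+1 = iota m n ++ [:: (m + n)%N].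
Proof. by rewrite -[in LHS]addn1 iotaD. Qed.

Lemma rrt_wordS f m :
  rrt_word f m.+1 = insert_after m.+2 (f m).+1 (rrt_word f m).
Proof. by rewrite /rrt_word iota_rcons foldl_cat. Qed.

Lemma insert_after_split i j w : uniq w -> j \in w ->
  exists u1 u2, w = u1 ++ j :: u2 /\ insert_after i j w = u1 ++ [:: j, i & u2].
Proof.
move=> uw jw; have [u1 [u2 E]] : exists u1 u2, w = u1 ++ j :: u2.
  by case/splitPr: jw => u1 u2; exists u1, u2.
exists u1, u2; split => //; move: uw; rewrite E cat_uniq /= => /and4P[_ ju ju2 _].
have notj u : j \notin u ->
    flatten [seq if x == j then [:: x; i] else [:: x] | x <- u] = u.
  elim: u => //= x u IHu; rewrite inE negb_or eq_sym => /andP[/negPf-> /IHu] /=.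
  by move=> ->.
rewrite /insert_after map_cat flatten_cat /= eqxx /= !notj//.
by apply: contra ju => jin; rewrite jin.
Qed.

Lemma perm_rrt_word f m : (forall i, i < m -> f i <= i)%N ->
  perm_eq (rrt_word f m) (iota 1 m.+1).
Proof.
elim: m => [|m IHm] fi //; have {}IHm := IHm (fun i im => fi i (ltnW im)).
have um : uniq (rrt_word f m) by rewrite (perm_uniq IHm) iota_uniq.
have jm : (f m).+1 \in rrt_word f m.
  by rewrite (perm_mem IHm) mem_iota; have := fi m (ltnSn m); lia.
have [u1 [u2 [E]]] := insert_after_split m.+2 um jm.
rewrite -rrt_wordS => ->.
rewrite -cat_rcons -[m.+2 :: u2]cat1s perm_catCA cat_rcons -E.
by rewrite [iota 1 m.+2]iota_rcons perm_sym perm_catC perm_sym perm_cat2l.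
Qed.

Lemma rrt_word_inj f g m : (forall i, i < m -> f i <= i)%N ->
  (forall i, i < m -> g i <= i)%N -> rrt_word f m = rrt_word g m ->
  forall i, (i < m)%N -> f i = g i.
Proof.
elim: m => [|m IHm] fi gi // E i.
have split_last h : (forall i, i < m.+1 -> h i <= i)%N -> exists u1 u2,
    [/\ rrt_word h m = u1 ++ (h m).+1 :: u2,
        rrt_word h m.+1 = u1 ++ [:: (h m).+1, m.+2 & u2] &
        m.+2 \notin rcons u1 (h m).+1].
  move=> hi; have pm := @perm_rrt_word h m (fun i im => hi i (ltnW im)).
  have um : uniq (rrt_word h m) by rewrite (perm_uniq pm) iota_uniq.
  have jm : (h m).+1 \in rrt_word h m.
    by rewrite (perm_mem pm) mem_iota; have := hi m (ltnSn m); lia.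
  have [u1 [u2 [E1]]] := insert_after_split m.+2 um jm.
  rewrite -rrt_wordS => E2; exists u1, u2; split => //.
  have : m.+2 \notin rrt_word h m by rewrite (perm_mem pm) mem_iota; lia.
  by apply: contra; rewrite E1 -cat_rcons mem_cat => ->.
have [u1 [u2 [Ef Ef' uf]]] := split_last f fi.
have [w1 [w2 [Eg Eg' wg]]] := split_last g gi.
move: E; rewrite Ef' Eg' -(cat_rcons _ u1) -(cat_rcons _ w1) => E.
have Ei : size (rcons u1 (f m).+1) = size (rcons w1 (g m).+1).
  have := congr1 (index m.+2) E.
  by rewrite !index_cat (negPf uf) (negPf wg) /= eqxx !addn0.
move/eqP: E; rewrite eqseq_cat// => /andP[/eqP E1 /eqP[E2]].
have [Eu [Efg]] : u1 = w1 /\ (f m) = (g m).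
  by move/rcons_inj: E1 => -[-> ->].
rewrite ltnS leq_eqVlt => /predU1P[->//|im].
apply: IHm => //; first by move=> k km; apply/fi/ltnW.
  by move=> k km; apply/gi/ltnW.
by rewrite Ef Eg Eu Efg E2.
Qed.

Lemma rrt_word_head f m : exists w, rrt_word f m = 1%N :: w.
Proof.
elim: m => [|m [w E]]; first by exists [::].
by rewrite rrt_wordS E /insert_after /=; case: ifP => _ /=; eexists.
Qed.

Lemma rrt_tree_cartesian f m : (forall i, i < m -> f i <= i)%N ->
  foldl (fun t i => attach i.+2 (f i).+1 t) (ONode 1%N [::]) (iota 0 m) =
  ONode 1%N (forest (cartesian id (behead (rrt_word f m)))).
Proof.
move=> fi; pose B m := foldl (fun t i => bin_attach i.+2 (f i).+1 t)
  (BNode (BEmpty nat) 1%N (BEmpty nat)) (iota 0 m).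
have BS k : B k.+1 = bin_attach k.+2 (f k).+1 (B k).
  by rewrite /B iota_rcons foldl_cat.
have inB k : inorder (B k) = rrt_word f k.
  elim: k => // k IHk; rewrite BS inorder_bin_attach IHk.
  by rewrite rrt_wordS.
have heapB k : (k <= m)%N -> heap id (B k).
  elim: k => // k IHk km; rewrite BS; apply: heap_bin_attach; last exact/IHk/ltnW.
  move=> x; rewrite inB (perm_mem (perm_rrt_word _)) ?mem_iota; first by lia.
  by move=> i ik; apply: fi; lia.
have forB k : forest (B k) = [:: foldl (fun t i => attach i.+2 (f i).+1 t)
    (ONode 1%N [::]) (iota 0 k)].
  elim: k => // k IHk.
  by rewrite BS -forest_attach IHk iota_rcons foldl_cat.
have := forB m; rewrite -(heap_cartesian (heapB m (leqnn m))) inB.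
have [w E] := rrt_word_head f m.
rewrite E -[1%N :: w]/([::] ++ 1%N :: w) cartesian_cat /=; first by case.
have := perm_rrt_word fi; rewrite E perm_cons => pw.
by apply/allP => x xw; move: (perm_mem pw x); rewrite xw mem_iota; lia.
Qed.

Lemma otree_shape_forest t : map otree_shape (forest t) = forest (bin_shape t).
Proof. by elim: t => //= l -> x r ->. Qed.

(** * Counting subtrees through windows *)

(** The flag tells right subtrees from left ones. Empty subtrees are listed as
    well, because the leaves of a recursive tree correspond to empty right
    subtrees. *)
Fixpoint flagged_subtrees (c : bool) (t : bintree unit) :
    seq (bool * bintree unit) :=
  (c, t) :: match t with
            | BEmpty => [::]
            | BNode l _ r => flagged_subtrees false l ++ flagged_subtrees true r
            end.

(** [c] selects between all subtrees (for binary search trees) and the right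
    ones only (for recursive trees). *)
Definition subtree_count (c : bool) (b : nat) (G : pred (bintree unit))
    (root_flag : bool) (t : bintree unit) : nat :=
  count (fun u => [&& bin_size u.2 == b, c || u.1 & G u.2])
    (flagged_subtrees root_flag t).

Lemma count_bin_subtrees k (G : pred (bintree unit)) t : (0 < k)%N ->
  count (fun u => (bin_size u == k) && G u) (bin_subtrees t) =
  subtree_count true k G false t.
Proof.
move=> k0; rewrite /subtree_count; move: false => flag.
elim: t flag => [|l IHl x r IHr] flag /=.
  by rewrite -(prednK k0).
by rewrite !count_cat /= -IHl -IHr.
Qed.

Lemma otree_size_forest t :
  sumn (map otree_size (forest t)) = bin_size t.
Proof. by elim: t => //= l -> x r ->; rewrite addSn addnC. Qed.

Lemma count_otree_subtrees k (G : pred (otree unit)) t : (0 < k)%N ->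
  count (fun u => (otree_size u == k) && G u)
    (flatten (map otree_subtrees (forest t))) =
  subtree_count false k.-1 (fun r => G (ONode tt (forest r))) false t.
Proof.
move=> k0; rewrite /subtree_count.
have gen flag : count (fun u => [&& bin_size u.2 == k.-1, false || u.1 &
      G (ONode tt (forest u.2))]) (flagged_subtrees flag t) =
    (([&& bin_size t == k.-1, flag & G (ONode tt (forest t))] : nat) +
    count (fun u => (otree_size u == k) && G u)
      (flatten (map otree_subtrees (forest t))))%N.
  elim: t flag => [|l IHl [] r IHr] flag //=.
  rewrite !count_cat /= IHl IHr /= andbF add0n otree_size_forest.
  rewrite -(eqn_add2r 1 (bin_size r)) !addn1 prednK//.
  by lia.
by rewrite gen /= andbF.
Qed.

(** The block occupies the positions from [i.+1] to [i + b]; its neighbours are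
    [i] and [(i + b).+1]. *)
Definition window (v : nat -> nat) (c : bool) (b : nat)
    (G : pred (bintree unit)) (i : nat) : bool :=
  [&& all (fun j => v i < v j)%N (iota i.+1 b),
      all (fun j => v (i + b).+1 < v j)%N (iota i.+1 b),
      c || (v (i + b).+1 < v i)%N &
      G (bin_shape (cartesian v (iota i.+1 b)))].

Lemma ex_argmin (v : nat -> nat) l h : (l.+1 < h)%N ->
  {in [pred j | l < j < h]%N &, injective v} ->
  exists m, (l < m < h)%N /\ forall j, (l < j < h)%N -> j != m -> (v m < v j)%N.
Proof.
move=> lh inj; have h0 : (0 < h)%N by lia.
have P0 : (l < l.+1)%N by [].
case: (@arg_minnP _ (Ordinal lh) [pred i : 'I_h | (l < i)%N] (fun i => v i) P0).
move=> m /= lm min_m.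
exists m; rewrite lm ltn_ord; split => // j /andP[lj jh] jm.
rewrite ltn_neqAle (min_m (Ordinal jh) lj) andbT; apply: contra jm => /eqP E.
by apply/eqP/esym/inj; rewrite ?inE ?lm ?ltn_ord ?lj ?jh.
Qed.

(** A block of positions spans a fringe subtree of a Cartesian tree exactly
    when its two neighbours have smaller values, and it hangs to the right of
    its parent when the left neighbour is the larger one. The recursion splits
    the interval at its minimum [m]: a block through [m] has both neighbours
    below [v m] only when it fills the interval. *)
Lemma count_windows v c b G l h M : (l < h <= M)%N ->
  {in [pred j | l < j < h]%N &, injective v} ->
  (forall j, l < j < h -> v l < v j /\ v h < v j)%N ->
  subtree_count c b G (v h < v l)%N
    (bin_shape (cartesian v (iota l.+1 (h - l.+1)))) =
  (\sum_(0 <= i < M) [&& l <= i, i + b < h & window v c b G i])%N.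
Proof.
rewrite /subtree_count.
have [d] := ubnP (h - l); elim: d l h => // d IHd l h hd lhM inj out.
have single (l' h' : nat) (p : nat -> bool) : (l' < h' <= M)%N ->
    (\sum_(0 <= i < M) [&& i == l', (i + b).+1 == h' & p i] =
     ((l' + b).+1 == h') && p l')%N.
  move=> /andP[lh' hM']; have lM : (l' < M)%N by exact: leq_trans lh' hM'.
  rewrite (bigD1_seq l') ?mem_index_iota ?iota_uniq //=.
  by rewrite eqxx big1 ?addn0// => i /negPf ->.
have whole : (l + b).+1 = h -> window v c b G l =
    (c || (v h < v l)%N) && G (bin_shape (cartesian v (iota l.+1 (h - l.+1)))).
  move=> E; rewrite /window E (_ : (h - l.+1 = b)%N); last by lia.
  have -> : all (fun j => v l < v j)%N (iota l.+1 b).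
    by apply/allP => j; rewrite mem_iota => jl; apply: (out j _).1; lia.
  have -> : all (fun j => v h < v j)%N (iota l.+1 b) => //.
  by apply/allP => j; rewrite mem_iota => jl; apply: (out j _).2; lia.
have [hl|hl] : (h = l.+1 \/ l.+1 < h)%N by lia.
  transitivity (\sum_(0 <= i < M)
      [&& i == l, (i + b).+1 == h & window v c b G i])%N; last first.
    apply: eq_bigr => i _; congr nat_of_bool.
    by case: (window v c b G i); rewrite ?andbF//; lia.
  rewrite single// hl subnn /= addn0.
  case: (altP (b =P 0%N)) => [b0|b0]; last first.
    have -> : (0%N == b) = false by rewrite eq_sym (negPf b0).
    by have -> : ((l + b).+1 == l.+1) = false by lia.
  by rewrite whole ?b0 ?addn0 ?hl ?subnn ?eqxx//=.
(* Windows below [m], above [m], and through [m]; the last kind has to fill the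
   interval. *)
have [m [lmh vm]] := ex_argmin hl inj.
have Es : iota l.+1 (h - l.+1) =
    iota l.+1 (m - l.+1) ++ m :: iota m.+1 (h - m.+1).
  rewrite (_ : (h - l.+1 = (m - l.+1) + (h - m.+1).+1)%N); last by lia.
  by rewrite iotaD (_ : (l.+1 + (m - l.+1) = m)%N)//; lia.
have sz : bin_size (bin_shape (cartesian v (iota l.+1 (h - l.+1)))) =
    (h - l.+1)%N.
  by rewrite bin_size_shape inorder_cartesian size_iota.
move: sz whole; rewrite {1 2}Es cartesian_cat /=; last first.
  apply/allP => j; rewrite mem_cat !mem_iota => jm.
  by apply: vm; lia.
set tl := bin_shape (cartesian v (iota l.+1 _)).
set tr := bin_shape (cartesian v (iota m.+1 _)) => sz whole.
rewrite -/tl -/tr Es cartesian_cat /=; last first.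
  apply/allP => j; rewrite mem_cat !mem_iota => jm.
  by apply: vm; lia.
have vlm := (out m lmh).1; have vhm := (out m lmh).2.
rewrite count_cat -/tl -/tr.
have := IHd l m; rewrite (_ : (v m < v l)%N = false); last by lia.
move=> ->; first last.
- by move=> j jlm; split; [apply: (out j _).1; lia|apply: vm; lia].
- by move=> j j' jl jl'; apply: inj; rewrite !inE in jl jl' *; lia.
- by lia.
- by lia.
have := IHd m h; rewrite vhm.
move=> ->; first last.
- by move=> j jlm; split; [apply: vm; lia|apply: (out j _).2; lia].
- by move=> j j' jl jl'; apply: inj; rewrite !inE in jl jl' *; lia.
- by lia.
- by lia.
rewrite sz.
have -> : [&& h - l.+1 == b, c || (v h < v l)%N & G (BNode tl tt tr)] =
    ((l + b).+1 == h) && window v c b G l.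
  case: (altP ((l + b).+1 =P h)) => [E|nE]; last first.
    by have -> : (h - l.+1 == b)%N = false by lia.
  rewrite whole//; suff -> : (h - l.+1 == b)%N by [].
  by apply/eqP; lia.
rewrite -(single l h (window v c b G)) ?lhM// -!big_split /=.
apply: eq_bigr => i _.
have [W|] := boolP (window v c b G i); last by rewrite !andbF.
rewrite !andbT.
case: (boolP (i < m < (i + b).+1)%N) => im; last by lia.
have /and4P[/allP W1 /allP W2 _ _] := W.
have vi : (v i < v m)%N by apply: W1; rewrite mem_iota; lia.
have vib : (v (i + b).+1 < v m)%N by apply: W2; rewrite mem_iota; lia.
case: (boolP (l < i)%N) => li.
  by have := vm i _ _; lia.
case: (boolP ((i + b).+1 < h)%N) => ih.
  by have := vm (i + b).+1 _ _; lia.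
by lia.
Qed.

(** * Uniform permutations as the common source of both random trees *)

Definition perm_val m (s : 'S_m) (a : nat) : nat :=
  if insub a is Some i then s i : nat else 0%N.

Definition perm_shape m (s : 'S_m) : bintree unit :=
  bin_shape (cartesian (perm_val s) (iota 0 m)).

Lemma perm_valE m (s : 'S_m) (i : 'I_m) : perm_val s i = s i.
Proof. by rewrite /perm_val valK. Qed.

(** Keys and insertion times exchange their roles under inversion. *)
Lemma bst_perm_shape n (s : 'S_n) : bst (s : bst_space n) = perm_shape s^-1%g.
Proof.
rewrite /bst; set w := [seq _ | i <- _].
have Ew : w = map succn [seq nat_of_ord (s i) | i <- enum 'I_n].
  by rewrite /w -map_comp.
have pw : perm_eq w (iota 1 n).
  rewrite Ew (iotaDl 1 0 n) (eq_map (fun i => add1n i)); apply: perm_map.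
  apply: uniq_perm; rewrite ?iota_uniq //.
    by rewrite map_inj_uniq ?enum_uniq// => i j /val_inj/perm_inj.
  move=> a; rewrite mem_iota add0n /=; apply/mapP/idP => [[i _ ->]|an].
    exact: ltn_ord.
  by exists (s^-1%g (Ordinal an)); rewrite ?mem_enum// permKV.
rewrite (bst_cartesian pw) (iotaDl 1 0 n) (eq_map (fun i => add1n i)).
rewrite (@cartesian_map (perm_val s^-1%g)) ?bin_shape_map//.
have idx x : (x < n)%N -> index x.+1 w = perm_val s^-1%g x.
  move=> xn; rewrite -[x]/(val (Ordinal xn)) perm_valE.
  have -> : (val (Ordinal xn)).+1 = (nat_of_ord (s (s^-1%g (Ordinal xn)))).+1.
    by rewrite permKV.
  rewrite /w (index_map (f := fun i => (nat_of_ord (s i)).+1)).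
    by rewrite index_enum_ord.
  by move=> i j [] /val_inj/perm_inj.
by move=> x y; rewrite !mem_iota !add0n => xn yn; rewrite !idx.
Qed.

Definition choice_val n (f : rrt_choice n) (i : nat) : nat :=
  if insub i is Some j then f j : nat else 0%N.

Lemma choice_valE n (f : rrt_choice n) (i : 'I_n.-1) : choice_val f i = f i.
Proof. by rewrite /choice_val valK. Qed.

Lemma choice_val_le n (f : rrt_choice n) i : (i < n.-1)%N -> (choice_val f i <= i)%N.
Proof. by move=> im; rewrite -[i]/(val (Ordinal im)) choice_valE -ltnS. Qed.

Lemma rrt_word_shape n (f : rrt_choice n) :
  rrt (f : rrt_space n) = ONode tt (forest (bin_shape
    (cartesian id (behead (rrt_word (choice_val f) n.-1))))).
Proof.
rewrite /rrt -otree_shape_forest -[RHS]/(otree_shape (ONode 1%N _)).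
congr otree_shape; rewrite -rrt_tree_cartesian; last exact: choice_val_le.
rewrite -val_enum_ord; elim/last_ind: (enum _) => //= s i IHs.
by rewrite map_rcons !foldl_rcons IHs choice_valE.
Qed.

(** The words of recursive trees are the permutations that start at the root,
    each one reached by exactly one sequence of choices. *)
Lemma rrt_perm_bij n : exists phi : rrt_choice n -> 'S_n.-1,
  bijective phi /\
  forall f, rrt (f : rrt_space n) = ONode tt (forest (perm_shape (phi f))).
Proof.
pose w (f : rrt_choice n) := behead (rrt_word (choice_val f) n.-1).
have Ew f : rrt_word (choice_val f) n.-1 = 1%N :: w f.
  by rewrite /w; have [u ->] := rrt_word_head (choice_val f) n.-1.
have pw f : perm_eq (w f) (iota 2 n.-1).
  have := perm_rrt_word (@choice_val_le n f).
  by rewrite Ew perm_cons.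
have sw f : size (w f) = n.-1 by rewrite (perm_size (pw f)) size_iota.
have uw f : uniq (w f) by rewrite (perm_uniq (pw f)) iota_uniq.
have nthw f (i : 'I_n.-1) : (2 <= nth 0%N (w f) i < n.-1.+2)%N.
  have : nth 0%N (w f) i \in w f by rewrite mem_nth ?sw.
  by rewrite (perm_mem (pw f)) mem_iota; lia.
have /boolp.choice[phi phiE] : forall f, exists s : 'S_n.-1,
    forall i : 'I_n.-1, (s i).+2 = nth 0%N (w f) i.
  move=> f; have lt (i : 'I_n.-1) : (nth 0%N (w f) i - 2 < n.-1)%N.
    by have := nthw f i; lia.
  have inj : injective (fun i : 'I_n.-1 => Ordinal (lt i)).
    move=> i j [E]; apply/val_inj/eqP => /=.
    rewrite -(nth_uniq 0%N _ _ (uw f)) ?sw//; apply/eqP.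
    move: E (nthw f i) (nthw f j) => /=.
    by lia.
  by exists (perm inj) => i; rewrite permE /=; have := nthw f i; lia.
exists phi; split.
  apply: inj_card_bij.
    move=> f g Efg; have Ewfg : w f = w g.
      apply: (@eq_from_nth _ 0%N); rewrite !sw// => i im.
      by rewrite -[i]/(val (Ordinal im)) -!phiE Efg.
    have : rrt_word (choice_val f) n.-1 = rrt_word (choice_val g) n.-1.
      by rewrite !Ew Ewfg.
    move/(rrt_word_inj (@choice_val_le n f) (@choice_val_le n g)) => E.
    apply/ffunP => i; apply: val_inj => /=.
    by rewrite -!choice_valE; apply: E.
  rewrite card_Sn card_dep_ffun /image_mem.
  have -> : [seq #|{: 'I_(nat_of_ord x).+1}| | x <- enum 'I_n.-1] = iota 1 n.-1.
    rewrite (iotaDl 1 0) -val_enum_ord -map_comp.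
    by apply: eq_map => i; rewrite card_ord /= add1n.
  suff -> : foldr muln 1%N (iota 1 n.-1) = n.-1`! by [].
  elim: (n.-1) => // k IHk; rewrite factS -IHk iota_rcons foldr_cat /=.
  rewrite muln1 add1n mulnC; elim: (iota 1 k) => [|x u IHu] /=.
    by rewrite mul1n.
  by rewrite IHu mulnA.
move=> f; rewrite rrt_word_shape -/(w f); congr (ONode tt (forest _)).
have -> : w f = [seq nth 0%N (w f) i | i <- iota 0 n.-1].
  by rewrite -(sw f) map_nth_iota0 ?take_size.
rewrite (@cartesian_map (perm_val (phi f))) ?bin_shape_map//.
move=> x y; rewrite !mem_iota !add0n => xn yn.
rewrite -[x]/(val (Ordinal xn)) -[y]/(val (Ordinal yn)) !perm_valE -!phiE.
by rewrite /=; lia.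
Qed.

(** * Cyclic windows *)

Section CyclicWindows.
Variables (m : nat) (c : bool) (b : nat) (G : pred (bintree unit)).
Local Open Scope ring_scope.
Implicit Types (s : 'S_m.+1) (i : 'I_m.+1).

(** The sequence of values seen from the position [i] of the cycle. *)
Definition cyc_val s i (a : nat) : nat := s (i + inZp a).

Definition cyc_window s i : bool := window (cyc_val s i) c b G 0.

Definition cyc_count s : nat := (\sum_i cyc_window s i)%N.

Definition rotation i : 'S_m.+1 := perm (addIr i).

Lemma cyc_count_rotation s j : cyc_count (rotation j * s)%g = cyc_count s.
Proof.
rewrite /cyc_count [RHS](reindex_inj (addrI j)) /=; apply: eq_bigr => i _.
rewrite /cyc_window; congr nat_of_bool; congr window; apply/funext => a.
by rewrite /cyc_val permM permE addrC addrA.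
Qed.

Lemma window_shift v (i : nat) : window (fun a => v (i + a)%N) c b G 0 = window v c b G i.
Proof.
have E : iota i.+1 b = map (addn i) (iota 1 b) by rewrite -iotaDl addn1.
rewrite /window E !all_map addn0 add0n addnS.
by rewrite (@cartesian_map (fun a => v (i + a)%N)) ?bin_shape_map.
Qed.

(** Once the minimum has been rotated to position 0 it separates the other
    positions like a wall on both sides, and no true window straddles it. *)
Lemma cyc_count_lift (t : 'S_m) : (b < m)%N ->
  cyc_count (lift_perm ord0 ord0 t) = subtree_count c b G false (perm_shape t).
Proof.
move=> bm; set s := lift_perm _ _ _.
pose v a : nat := s (inZp a).
have v0 : v 0%N = 0%N.
  by rewrite /v (_ : inZp 0 = ord0) ?lift_perm_id//; apply: val_inj; rewrite /= mod0n.
have vN : v m.+1 = 0%N.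
  by rewrite /v (_ : inZp _ = ord0) ?lift_perm_id//; apply: val_inj; rewrite /= modnn.
have inZpS (a : nat) (am : (a < m)%N) : inZp a.+1 = lift ord0 (Ordinal am) :> 'I_m.+1.
  by apply: val_inj; rewrite /= modn_small.
have vS a (am : (a < m)%N) : v a.+1 = (t (Ordinal am)).+1.
  by rewrite /v inZpS lift_perm_lift lift0.
have := @count_windows v c b G 0 m.+1 m.+1; rewrite v0 vN subn1 /=.
have -> : bin_shape (cartesian v (iota 1 m)) = perm_shape t.
  rewrite (iotaDl 1 0 m) (@cartesian_map (perm_val t)) ?bin_shape_map//.
  move=> x y; rewrite !mem_iota !add0n !add1n => xm ym.
  rewrite !vS.
  by rewrite ltnS -!perm_valE.
move=> ->//; first last.
- by move=> [//|j] /andP[_ jm]; rewrite vS.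
- move=> [//|x] [//|y]; rewrite !inE /= => xm ym; rewrite !vS => -[] /val_inj.
  by move/perm_inj => -[->].
rewrite /cyc_count big_mkord; apply: eq_bigr => i _; congr nat_of_bool.
have -> : cyc_window s i = window v c b G i.
  rewrite /cyc_window -(window_shift v); congr window; apply/funext => a.
  rewrite /cyc_val /v; congr (nat_of_ord (s _)).
  by apply: val_inj; rewrite /= modnDmr.
rewrite /=; case: ltnP => // ib; apply/negbTE/negP => /and4P[/allP W _ _ _].
have := W m.+1; rewrite vN ltn0 => Wm; apply/notF/Wm.
by rewrite mem_iota; have := ltn_ord i; lia.
Qed.

End CyclicWindows.

(** * Averages over permutations *)

Section Average.
Variables (R : realType) (T : finType).
Local Open Scope ring_scope.
Implicit Types g h : T -> R.

Definition avg g : R := (\sum_x g x) / #|T|%:R.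

Lemma eq_avg g h : g =1 h -> avg g = avg h.
Proof. by move=> gh; rewrite /avg (eq_bigr h). Qed.

Lemma avgD g h : avg (fun x => g x + h x) = avg g + avg h.
Proof. by rewrite /avg big_split mulrDl. Qed.

Lemma avgN g : avg (fun x => - g x) = - avg g.
Proof. by rewrite /avg sumrN mulNr. Qed.

Lemma avgZ (a : R) g : avg (fun x => a * g x) = a * avg g.
Proof. by rewrite /avg -mulr_sumr mulrA. Qed.

Lemma avg_sum (I : Type) (r : seq I) (P : pred I) (g : I -> T -> R) :
  avg (fun x => \sum_(i <- r | P i) g i x) = \sum_(i <- r | P i) avg (g i).
Proof. by rewrite /avg exchange_big /= mulr_suml. Qed.

Lemma le_avg g h : (forall x, g x <= h x) -> avg g <= avg h.
Proof.
by move=> gh; rewrite ler_wpM2r ?invr_ge0 ?ler0n//; apply: ler_sum => x _.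
Qed.

Lemma avg_ge0 g : (forall x, 0 <= g x) -> 0 <= avg g.
Proof. by move=> g0; rewrite divr_ge0// sumr_ge0. Qed.

Lemma ler_norm_avg g : `|avg g| <= avg (fun x => `|g x|).
Proof.
rewrite /avg normrM normfV normr_nat ler_wpM2r ?invr_ge0//.
exact: ler_norm_sum.
Qed.

Lemma avg_cst (a : R) : (0 < #|T|)%N -> avg (fun=> a) = a.
Proof.
by move=> T0; rewrite /avg sumr_const -[X in X / _]mulr_natr mulfK// pnatr_eq0 -lt0n.
Qed.

End Average.

Lemma avg_bij (R : realType) (S T : finType) (phi : S -> T) (g : T -> R) :
  bijective phi -> avg (fun x => g (phi x)) = avg g.
Proof.
move=> bphi; rewrite /avg (bij_eq_card bphi); congr (_ / _)%R.
by rewrite [RHS](reindex phi)//; apply: onW_bij.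
Qed.

Lemma card_Sn_gt0 n : (0 < #|{: 'S_n}|)%N.
Proof. by rewrite card_Sn fact_gt0. Qed.

(** Rotating the minimum to the origin cuts the cycle open; every permutation
    of the cycle arises from exactly one rotation and one linear order. *)
Lemma avg_cyc_count (R : realType) (m : nat) (c : bool) (b : nat)
    (G : pred (bintree unit)) (h : nat -> R) : (b < m)%N ->
  avg (fun s : 'S_m.+1 => h (cyc_count c b G s)) =
  avg (fun t : 'S_m => h (subtree_count c b G false (perm_shape t))).
Proof.
move=> bm.
pose phi (u : 'I_m.+1 * 'S_m) := (rotation u.1 * lift_perm ord0 ord0 u.2)%g.
have phiE u x : phi u x = lift_perm ord0 ord0 u.2 (x + u.1)%R.
  by rewrite /phi permM [rotation _ x]permE.
have bphi : bijective phi.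
  apply: inj_card_bij; last by rewrite card_prod !card_Sn card_ord factS.
  move=> [i t] [j t'] E.
  have Eij : i = j.
    have : phi (i, t) (- i)%R = ord0 by rewrite phiE /= addNr lift_perm_id.
    rewrite E phiE /= -[RHS](lift_perm_id ord0 ord0 t').
    move=> /perm_inj/eqP.
    by rewrite -[ord0]/(0%R : 'I_m.+1) addrC subr_eq0 => /eqP.
  subst j; congr (_, _); apply/permP => k.
  have /(congr1 (fun p : 'S_m.+1 => p (lift ord0 k - i)%R)) := E.
  by rewrite !phiE /= subrK !lift_perm_lift => /lift_inj.
rewrite -(avg_bij _ bphi) /avg card_prod natrM card_ord invfM mulrA.
congr (_ / _)%R.
rewrite -(pair_bigA _ (fun i t => h (cyc_count c b G (phi (i, t))))) /=.
under eq_bigr do under eq_bigr do rewrite cyc_count_rotation cyc_count_lift//.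
by rewrite /= big_const_ord iter_addr addr0 -[X in (X / _)%R]mulr_natr mulfK.
Qed.

(** * Relative orders in a uniform permutation *)

Section Exchangeability.
Variables (R : realType) (m b : nat) (i : 'I_m.+1).
Variable G : pred (bintree unit).
Local Open Scope ring_scope.
Implicit Types (s t : 'S_m.+1) (r : seq nat) (H : 'S_m.+1 -> R).

Definition cyc_pos (a : nat) : 'I_m.+1 := i + inZp a.

Definition positions r : {set 'I_m.+1} := [set x in map cyc_pos r].

(** Such functions are independent of the relative order in [r]. *)
Definition blind r H := forall t s, perm_on (positions r) t -> H (t * s)%g = H s.

Definition first_in r (a : nat) s : bool :=
  all (fun j => cyc_val s i a <= cyc_val s i j)%N r.

Lemma cyc_pos_inj a a' : (a < m.+1)%N -> (a' < m.+1)%N ->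
  (cyc_pos a == cyc_pos a') = (a == a').
Proof.
move=> am am'; rewrite /cyc_pos (inj_eq (addrI i)) -val_eqE /=.
by rewrite !modn_small.
Qed.

Lemma mem_positions r a : all (fun j => j < m.+1)%N (a :: r) ->
  (cyc_pos a \in positions r) = (a \in r).
Proof.
move=> /= /andP[am /allP rm]; rewrite inE; apply/mapP/idP => [[j jr /eqP]|ar].
  by rewrite cyc_pos_inj ?(rm j)// => /eqP ->.
by exists a.
Qed.

Lemma blind_cst (a : R) r : blind r (fun=> a).
Proof. by []. Qed.

Lemma blindM r H H' : blind r H -> blind r H' -> blind r (fun s => H s * H' s).
Proof. by move=> h h' t s tr; rewrite h// h'. Qed.

Lemma blind_first_in r r' a : all (fun j => j < m.+1)%N (r ++ r') ->
  a \in r -> a \notin r' -> {subset r' <= r} \/ {in r, forall j, j \notin r'} ->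
  blind r' (fun s => (first_in r a s)%:R).
Proof.
rewrite all_cat => /andP[rm rm'] ar ar' h t s tr'; congr (_%:R).
have out j : j \in r -> j \notin r' -> t (cyc_pos j) = cyc_pos j.
  move=> jr jr'; apply: (out_perm tr').
  by rewrite mem_positions//= (allP rm)// rm'.
rewrite /first_in /cyc_val !permM out//; congr nat_of_bool.
case: h => [sub|dis]; last first.
  by apply: eq_in_all => j jr; rewrite permM out// dis.
have tr : perm_on (positions r) t.
  apply: (fintype.subset_trans tr'); apply/fintype.subsetP => x; rewrite !inE => /mapP[j jr ->].
  by rewrite map_f// sub.
have inr (x : 'I_m.+1) : reflect (exists2 j, j \in r & x = cyc_pos j) (x \in positions r).
  by rewrite inE; exact: mapP.
apply/allP/allP => hs j jr; last first.
  rewrite permM; have : t (cyc_pos j) \in positions r.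
    by rewrite (perm_closed _ tr); apply/inr; exists j.
  by move=> /inr[k kr ->]; apply: hs.
have : (t^-1)%g (cyc_pos j) \in positions r.
  by rewrite -(perm_closed _ tr) permKV; apply/inr; exists j.
move=> /inr[k kr E]; have := hs k kr.
by rewrite permM -/(cyc_pos k) -E permKV.
Qed.

(** Transpositions of positions in [r] carry the event for one position into
    the event for another, and exactly one of these events occurs. *)
Lemma avg_first_in r a H : uniq r -> all (fun j => j < m.+1)%N r -> a \in r ->
  blind r H ->
  avg (fun s => (first_in r a s)%:R * H s) = avg H / (size r)%:R.
Proof.
move=> ur rm ar Hr.
have r0 : (size r)%:R != 0 :> R.
  by rewrite pnatr_eq0 -lt0n; case: (r) ar.
have swap a' : a' \in r ->
    avg (fun s => (first_in r a' s)%:R * H s) =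
    avg (fun s => (first_in r a s)%:R * H s).
  move=> ar'; pose t := tperm (cyc_pos a) (cyc_pos a').
  have tr : perm_on (positions r) t.
    apply/fintype.subsetP => x; rewrite inE /t; apply: contraNT => xr.
    rewrite tpermD//; apply: contraNneq xr => <-; rewrite inE map_f//.
  rewrite -(@avg_bij _ _ _ (fun s => t * s)%g); last first.
    by exists (fun s => t^-1 * s)%g => s; rewrite mulgA ?mulVg ?mulgV mul1g.
  apply: eq_avg => s /=; rewrite Hr//; congr (_%:R * _).
  rewrite /first_in /cyc_val !permM -/(cyc_pos a') tpermR.
  have tK j : j \in r -> exists2 j', j' \in r & t (cyc_pos j) = cyc_pos j'.
    move=> jr; have : t (cyc_pos j) \in positions r.
      by rewrite (perm_closed _ tr) inE map_f.
    by rewrite inE => /mapP.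
  congr nat_of_bool; apply/allP/allP => hs j jr; have [k kr E] := tK j jr.
    by have := hs k kr; rewrite permM -/(cyc_pos k) -E tpermK.
  by rewrite permM -/(cyc_pos j) E; apply: hs.
apply: (mulfI r0); rewrite [RHS]mulrCA divff// mulr1.
transitivity (\sum_(j <- r) avg (fun s => (first_in r j s)%:R * H s)).
  rewrite big_seq (eq_bigr _ swap) -big_seq big_const_seq count_predT.
  by rewrite iter_addr addr0 mulr_natl.
rewrite -avg_sum; apply: eq_avg => s; rewrite -mulr_suml.
suff -> : \sum_(j <- r) (first_in r j s)%:R = 1 :> R by rewrite mul1r.
have h0 : has (mem r) r by apply/hasP; exists a.
have [k kr kmin] : exists2 k, k \in r & first_in r k s.
  have ex : exists v, has (fun j => cyc_val s i j == v) r.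
    by exists (cyc_val s i a); apply/hasP; exists a.
  case: (ex_minnP ex) => v /hasP[k kr /eqP Ek] vmin; exists k => //.
  by apply/allP => j jr; rewrite Ek; apply: vmin; apply/hasP; exists j.
rewrite (bigD1_seq k)//= kmin big_seq_cond big1 ?addr0// => j /andP[jr jk].
case: (boolP (first_in r j s)) => // jmin; case/negP: jk.
rewrite -cyc_pos_inj ?(allP rm)//; apply/eqP/(@perm_inj _ s)/val_inj/eqP.
by rewrite eqn_leq (allP kmin)// (allP jmin).
Qed.

End Exchangeability.
Section Patterns.
Variables (R : realType) (m b : nat) (i : 'I_m.+1) (G : pred (bintree unit)).
Local Open Scope ring_scope.
Implicit Types (s t : 'S_m.+1) (r : seq nat) (H : 'S_m.+1 -> R).

Definition pattern (lo : nat) s : bool :=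
  G (bin_shape (cartesian (cyc_val s i) (iota lo b))).

Definition shape_prob : R := avg (fun u : 'S_b => (G (perm_shape u))%:R).

Lemma ex_standardization (v : 'I_b -> nat) : injective v ->
  exists u : 'S_b, forall x y, (u x < u y)%N = (v x < v y)%N.
Proof.
move=> vi; suff [f [lt rank]] : exists f : 'I_b -> nat,
    (forall x, f x < b)%N /\ forall x y, (f x < f y)%N = (v x < v y)%N.
  have inj : injective (fun x => Ordinal (lt x)).
    move=> x y /(congr1 (@nat_of_ord b)) /= E.
    by apply: vi; case: (ltngtP (v x) (v y)) => //; rewrite -rank E ltnn.
  by exists (perm inj) => x y; rewrite !permE /= rank.
pose below x := [set z | (v z < v x)%N].
exists (fun x => #|below x|); split=> [x|x y].
  rewrite -[X in (_ < X)%N]card_ord; apply: proper_card.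
  apply/fintype.properP; split; first exact/fintype.subsetP.
  by exists x; rewrite ?inE// ltnn.
have mono x' y' : (v x' < v y')%N -> (#|below x'| < #|below y'|)%N.
  move=> xy; apply: proper_card; apply/fintype.properP; split.
    by apply/fintype.subsetP => z; rewrite !inE => /ltn_trans; apply.
  by exists x'; rewrite !inE ?ltnn.
case: (ltngtP (v x) (v y)) => [|yx|E]; first exact: mono.
  by apply/negbTE; rewrite -leqNgt ltnW// mono.
by rewrite (vi _ _ E) ltnn.
Qed.

Lemma ex_extension (lo : nat) (u : 'S_b) : (lo + b <= m.+1)%N ->
  exists t : 'S_m.+1, perm_on (positions i (iota lo b)) t /\
    forall a : 'I_b, t (cyc_pos i (lo + a)) = cyc_pos i (lo + u a).
Proof.
move=> lob; pose e (a : 'I_b) := cyc_pos i (lo + a).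
have ei : injective e.
  move=> x y /eqP; rewrite cyc_pos_inj; first by rewrite eqn_add2l => /eqP/val_inj.
  - by have := ltn_ord x; lia.
  - by have := ltn_ord y; lia.
pose ext x := if [pick a | e a == x] is Some a then e (u a) else x.
have ext_e a : ext (e a) = e (u a).
  by rewrite /ext; case: pickP => [a' /eqP/ei -> //|/(_ a)]; rewrite eqxx.
have ext_out x : (forall a, e a != x) -> ext x = x.
  by move=> xo; rewrite /ext; case: pickP => // a /negPn; rewrite xo.
have ext_inj : injective ext.
  have cases x : (exists a, x = e a) \/ (forall a, e a != x).
    have [/existsP[a /eqP <-]|/existsPn] := boolP [exists a, e a == x].
      by left; exists a.
    by right.
  move=> x y; case: (cases x) => [[a ->]|xo]; case: (cases y) => [[a' ->]|yo].
  - by rewrite !ext_e => /ei/perm_inj ->.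
  - by rewrite ext_e (ext_out _ yo) => E; case/eqP: (yo (u a)).
  - by rewrite ext_e (ext_out _ xo) => E; case/eqP: (xo (u a')).
  - by rewrite !ext_out.
exists (perm ext_inj); split; last by move=> a; rewrite permE ext_e.
apply/fintype.subsetP => x; rewrite inE permE; apply: contraNT => xo.
rewrite ext_out// => a; apply: contraNneq xo => <-.
by rewrite inE /e map_f// mem_iota; have := ltn_ord a; lia.
Qed.

(** Averaging over the permutations of a block turns its relative order into a
    uniform permutation, whatever happens elsewhere. *)
Lemma avg_pattern lo H : (lo + b <= m.+1)%N -> blind i (iota lo b) H ->
  avg (fun s => (pattern lo s)%:R * H s) = shape_prob * avg H.
Proof.
move=> lob Hb.
have b0 : #|{: 'S_b}|%:R != 0 :> R by rewrite pnatr_eq0 -lt0n card_Sn_gt0.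
apply: (mulfI b0); rewrite [RHS]mulrA.
have -> : #|{: 'S_b}|%:R * shape_prob = \sum_(u : 'S_b) (G (perm_shape u))%:R.
  by rewrite /shape_prob /avg mulrC divfK.
transitivity (\sum_(u : 'S_b) avg (fun s => (pattern lo s)%:R * H s)).
  by rewrite sumr_const [LHS]mulr_natl.
have /boolp.choice[ext extE] := fun u => ex_extension u lob.
transitivity (\sum_(u : 'S_b) avg (fun s => (pattern lo (ext u * s)%g)%:R * H s)).
  apply: eq_bigr => u _.
  rewrite -(@avg_bij _ _ _ (fun s => ext u * s)%g); last first.
    by exists (fun s => (ext u)^-1 * s)%g => s; rewrite mulgA ?mulVg ?mulgV mul1g.
  by apply: eq_avg => s /=; rewrite Hb//; have [] := extE u.
rewrite -avg_sum -avgZ; apply: eq_avg => s; rewrite -mulr_suml; congr (_ * _).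
have [|w ws] := @ex_standardization (fun a => cyc_val s i (lo + a)).
  move=> x y /val_inj/perm_inj/eqP.
  rewrite -/(cyc_pos i (lo + x)) -/(cyc_pos i (lo + y)) cyc_pos_inj.
  - by rewrite eqn_add2l => /eqP/val_inj.
  - by have := ltn_ord x; lia.
  - by have := ltn_ord y; lia.
rewrite [RHS](reindex_inj (mulIg w)) /=; apply: eq_bigr => u _.
congr ((_ : bool)%:R); rewrite /pattern -{1}[lo]addn0 iotaDl.
rewrite (@cartesian_map (perm_val (u * w)%g)) ?bin_shape_map//.
move=> x y; rewrite !mem_iota !add0n => /= xb yb.
have cval z (zb : (z < b)%N) : cyc_val (ext u * s)%g i (lo + z) =
    cyc_val s i (lo + u (Ordinal zb)).
  rewrite /cyc_val permM -/(cyc_pos i (lo + z)).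
  by have [_ /(_ (Ordinal zb)) ->] := extE u.
have pval z (zb : (z < b)%N) : perm_val (u * w)%g z = w (u (Ordinal zb)).
  by have := perm_valE (u * w)%g (Ordinal zb); rewrite permM.
by rewrite !cval -ws !pval.
Qed.

Lemma blind_pattern lo r : (lo + b <= m.+1)%N ->
  all (fun j => j < m.+1)%N r -> {in iota lo b, forall j, j \notin r} ->
  blind i r (fun s => (pattern lo s)%:R : R).
Proof.
move=> lob rm dis t s tr; congr (_%:R); rewrite /pattern.
congr nat_of_bool; congr (G _).
rewrite -[in RHS](map_id (iota lo b)) (@cartesian_map (cyc_val (t * s)%g i)).
  by rewrite bin_shape_map.
have fix_ x : x \in iota lo b -> cyc_val (t * s)%g i x = cyc_val s i x.
  move=> xb; rewrite /cyc_val permM (out_perm tr)//.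
  rewrite -/(cyc_pos i x) mem_positions ?dis//= rm andbT.
  by move: xb; rewrite mem_iota; lia.
by move=> x y xb yb; rewrite !fix_.
Qed.

End Patterns.

(** * Probabilities of one window and of two windows sharing a boundary *)

Section WindowBounds.
Variables (R : realType) (m : nat) (c : bool) (b : nat).
Variable G : pred (bintree unit).
Local Open Scope ring_scope.
Implicit Types (s : 'S_m.+1) (i : 'I_m.+1) (H : 'S_m.+1 -> R).

Local Notation p := (shape_prob R b G).
Local Notation win s i := (cyc_window c b G s i).

Definition window_prob : R := (1 + c%:R) * p / ((b%:R + 1) * (b%:R + 2)).

Lemma blind_sub i r r' H : {subset r' <= r} -> blind i r H -> blind i r' H.
Proof.
move=> sub Hr t s tr; apply: Hr; apply: fintype.subset_trans tr _.
apply/fintype.subsetP => x; rewrite !inE => /mapP[a ar ->].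
by rewrite map_f// sub.
Qed.

Lemma blind_first_iota i lo n lo' n' a :
  (lo <= a < lo + n)%N -> ~~ (lo' <= a < lo' + n')%N ->
  (lo + n <= m.+1)%N -> (lo' + n' <= m.+1)%N ->
  (lo <= lo' /\ lo' + n' <= lo + n \/ lo + n <= lo' \/ lo' + n' <= lo)%N ->
  blind i (iota lo' n') (fun s => (first_in i (iota lo n) a s)%:R : R).
Proof.
move=> a1 a2 n1 n2 h; apply: blind_first_in; rewrite ?mem_iota//.
  by apply/allP => j; rewrite mem_cat !mem_iota; lia.
case: h => h; [left|right] => j; rewrite !mem_iota; lia.
Qed.

Lemma avg_first_iota i lo n a H : (lo <= a < lo + n)%N -> (lo + n <= m.+1)%N ->
  blind i (iota lo n) H ->
  avg (fun s => (first_in i (iota lo n) a s)%:R * H s) = avg H / n%:R.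
Proof.
move=> la ln Hb; rewrite -[in RHS](size_iota lo n); apply: avg_first_in => //.
- exact: iota_uniq.
- by apply/allP => j; rewrite mem_iota; lia.
- by rewrite mem_iota.
Qed.

Lemma cyc_val_neq s i a a' : (a < m.+1)%N -> (a' < m.+1)%N -> a != a' ->
  cyc_val s i a != cyc_val s i a'.
Proof.
move=> am am'; apply: contra => /eqP/val_inj/perm_inj/eqP.
by rewrite -/(cyc_pos i a) -/(cyc_pos i a') cyc_pos_inj.
Qed.

Lemma avg_two_patterns i H : (2 * b + 2 <= m.+1)%N ->
  blind i (iota 1 b) H -> blind i (iota b.+2 b) H ->
  avg (fun s => (pattern b i G 1 s)%:R * ((pattern b i G b.+2 s)%:R * H s)) =
  p ^+ 2 * avg H.
Proof.
move=> bN H1 H2; rewrite avg_pattern.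
- by rewrite avg_pattern//; [ring|lia].
- by lia.
- apply: blindM => //; apply: blind_pattern; first by lia.
    by apply/allP => j; rewrite mem_iota; lia.
  by move=> j; rewrite !mem_iota; lia.
Qed.

Lemma cyc_window_next s i d : win s (cyc_pos i d) = window (cyc_val s i) c b G d.
Proof.
rewrite -window_shift /cyc_window; congr window; apply/funext => a.
rewrite /cyc_val /cyc_pos -addrA; congr (nat_of_ord (s (_ + _))).
by apply: val_inj; rewrite /= modnDm.
Qed.

(** The left boundary [d] of the second block would lie in the first block, so
    its value would exceed the value at the right boundary of the first block;
    but that boundary lies in the second block, whose values exceed that at
    [d]. *)
Lemma overlapping_windows s i d : (0 < d <= b)%N -> win s i -> win s (cyc_pos i d) ->
  False.
Proof.
move=> db; rewrite cyc_window_next => /and4P[_ /allP wi _ _] /and4P[/allP wj _ _ _].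
have h1 : (cyc_val s i b.+1 < cyc_val s i d)%N.
  by rewrite -[b]add0n; apply: wi; rewrite mem_iota; lia.
have h2 : (cyc_val s i d < cyc_val s i b.+1)%N.
  by apply: wj; rewrite mem_iota; lia.
by lia.
Qed.

(** The five events below go through the possible orders of the two outer
    boundaries and the shared one. In each order the conditions imply that three
    nested or disjoint sets of more than [b] positions have their minima at
    prescribed places, which costs a factor at most [(b + 1)^-1] for each set. *)
Lemma avg_window_pair i : (2 * b + 3 <= m.+1)%N ->
  avg (fun s => (win s i && win s (cyc_pos i b.+1))%:R : R) <=
  5 * p ^+ 2 / (b%:R + 1) ^+ 3.
Proof.
move=> bN.
pose E lo1 n1 a1 lo2 n2 a2 lo3 n3 a3 s : R :=
  (first_in i (iota lo3 n3) a3 s)%:R *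
  ((first_in i (iota lo2 n2) a2 s)%:R * (first_in i (iota lo1 n1) a1 s)%:R).
have avgE lo1 n1 a1 lo2 n2 a2 lo3 n3 a3 :
    (lo1 <= a1 < lo1 + n1)%N -> (lo2 <= a2 < lo2 + n2)%N ->
    (lo3 <= a3 < lo3 + n3)%N ->
    ~~ (lo2 <= a1 < lo2 + n2)%N -> ~~ (lo3 <= a1 < lo3 + n3)%N ->
    ~~ (lo3 <= a2 < lo3 + n3)%N ->
    [&& lo1 + n1 <= m.+1, lo2 + n2 <= m.+1 & lo3 + n3 <= m.+1]%N ->
    (lo1 <= lo2 /\ lo2 + n2 <= lo1 + n1 \/ lo1 + n1 <= lo2 \/ lo2 + n2 <= lo1)%N ->
    (lo1 <= lo3 /\ lo3 + n3 <= lo1 + n1 \/ lo1 + n1 <= lo3 \/ lo3 + n3 <= lo1)%N ->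
    (lo2 <= lo3 /\ lo3 + n3 <= lo2 + n2 \/ lo2 + n2 <= lo3 \/ lo3 + n3 <= lo2)%N ->
    (b < n1)%N -> (b < n2)%N -> (b < n3)%N ->
    avg (E lo1 n1 a1 lo2 n2 a2 lo3 n3 a3) <= ((b%:R + 1) ^+ 3)^-1.
  move=> ? ? ? ? ? ? /and3P[? ? ?] ? ? ? bn1 bn2 bn3.
  rewrite avg_first_iota//; last by apply: blindM; apply: blind_first_iota.
  rewrite avg_first_iota//; last exact: blind_first_iota.
  have := @avg_first_iota i lo1 n1 a1 (fun=> 1).
  under eq_avg do rewrite mulr1.
  move=> ->//; rewrite avg_cst ?card_Sn_gt0//.
  rewrite mul1r -!invfM natr1 -!natrM -natrX lef_pV2 ?posrE ?ltr0n ?ler_nat.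
  - by rewrite !expnS expn0 muln1 mulnA !leq_mul.
  - by rewrite !muln_gt0; lia.
  - by rewrite expn_gt0.
pose A s := E 0%N (2 * b + 3)%N b.+1 0%N b.+1 0%N b.+2 b.+1 (2 * b + 2)%N s +
  (E 0%N (2 * b + 3)%N 0%N 1%N (2 * b + 2)%N b.+1 b.+2 b.+1 (2 * b + 2)%N s +
  (E 0%N (2 * b + 3)%N (2 * b + 2)%N 0%N (2 * b + 2)%N b.+1 0%N b.+1 0%N s +
  (E 0%N (2 * b + 3)%N 0%N 1%N (2 * b + 2)%N (2 * b + 2)%N 1%N (2 * b + 1)%N b.+1 s +
   E 0%N (2 * b + 3)%N (2 * b + 2)%N 0%N (2 * b + 2)%N 0%N 1%N (2 * b + 1)%N b.+1 s))).
have blindE lo lo1 n1 a1 lo2 n2 a2 lo3 n3 a3 t s :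
    perm_on (positions i (iota lo b)) t ->
    [/\ blind i (iota lo b) (fun s => (first_in i (iota lo1 n1) a1 s)%:R : R),
        blind i (iota lo b) (fun s => (first_in i (iota lo2 n2) a2 s)%:R : R) &
        blind i (iota lo b) (fun s => (first_in i (iota lo3 n3) a3 s)%:R : R)] ->
    E lo1 n1 a1 lo2 n2 a2 lo3 n3 a3 (t * s)%g =
    E lo1 n1 a1 lo2 n2 a2 lo3 n3 a3 s.
  by move=> tr [h1 h2 h3]; rewrite /E h1// h2// h3.
have blindA lo : lo = 1%N \/ lo = b.+2 -> blind i (iota lo b) A.
  move=> lob t s tr; rewrite /A !(blindE lo)//; split; apply: blind_first_iota; lia.
pose X := avg (fun s =>
  (pattern b i G 1 s)%:R * ((pattern b i G b.+2 s)%:R * A s)).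
suff leX : avg (fun s => (win s i && win s (cyc_pos i b.+1))%:R : R) <= X.
  apply: le_trans leX _; rewrite /X.
  rewrite avg_two_patterns; [|lia|by apply: blindA; left|by apply: blindA; right].
  rewrite [leRHS](_ : _ = p ^+ 2 * (5 * ((b%:R + 1) ^+ 3)^-1)); last by ring.
  rewrite ler_wpM2l ?sqr_ge0//.
  rewrite !avgD (_ : 5 = 1 + (1 + (1 + (1 + 1))) :> R); last by lra.
  by rewrite !mulrDl mul1r !lerD//; apply: avgE; lia.
apply: le_avg => s; rewrite /A /E.
case: (boolP (_ && _)) => [/andP[]|_]; last first.
  by rewrite !mulr_ge0 ?addr_ge0// ?mulr_ge0.
rewrite cyc_window_next => /and4P[/allP wx /allP ws _ wp] /and4P[/allP ws' /allP wy _ wp'].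
have -> : pattern b i G 1 s by [].
have -> : pattern b i G b.+2 s by [].
rewrite !mul1r -!natrM -!natrD ler_nat !mulnb.
have h1 j : (0 < j <= b)%N -> (cyc_val s i 0 < cyc_val s i j)%N /\
    (cyc_val s i b.+1 < cyc_val s i j)%N.
  by move=> jb; split; [apply: wx|apply: ws]; rewrite mem_iota; lia.
have h2 j : (b.+1 < j <= 2 * b + 1)%N -> (cyc_val s i b.+1 < cyc_val s i j)%N /\
    (cyc_val s i (2 * b + 2) < cyc_val s i j)%N.
  move=> jb; split; first by apply: ws'; rewrite mem_iota; lia.
  rewrite (_ : (2 * b + 2 = (b.+1 + b).+1)%N); last by lia.
  by apply: wy; rewrite mem_iota; lia.
have first lo n a : (lo + n <= 2 * b + 3)%N ->
    (forall j, (lo <= j < lo + n)%N ->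
      (j = 0 \/ j = b.+1 \/ j = 2 * b + 2 \/
       cyc_val s i 0 < cyc_val s i j /\ cyc_val s i b.+1 < cyc_val s i j /\
         j <= b \/
       cyc_val s i b.+1 < cyc_val s i j /\
         cyc_val s i (2 * b + 2) < cyc_val s i j /\ b.+1 < j)%N ->
      cyc_val s i a <= cyc_val s i j)%N ->
    first_in i (iota lo n) a s.
  move=> ln h; apply/allP => j; rewrite mem_iota => jl; apply: h => //.
  have : (j = 0 \/ j = b.+1 \/ j = 2 * b + 2 \/ (0 < j <= b) \/
    (b.+1 < j <= 2 * b + 1))%N by lia.
  case=> [|[|[|[jb|jb]]]]; [by tauto..| |].
    by have := h1 j jb; have := jb; do 3 right; left; lia.
  by have := h2 j jb; have := jb; do 4 right; lia.
rewrite !addn_gt0 !lt0b.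
have [le1|lt1] := leqP (cyc_val s i 0) (cyc_val s i b.+1);
  have [le2|lt2] := leqP (cyc_val s i b.+1) (cyc_val s i (2 * b + 2)).
- have F1 : first_in i (iota 0 (2 * b + 3)) 0 s.
    by apply: first => [|j jl]; [|move=> [E1|[E1|[E1|[E1|E1]]]]; subst]; lia.
  have F2 : first_in i (iota 1 (2 * b + 2)) b.+1 s.
    by apply: first => [|j jl]; [|move=> [E1|[E1|[E1|[E1|E1]]]]; subst]; lia.
  have F3 : first_in i (iota b.+2 b.+1) (2 * b + 2) s.
    by apply: first => [|j jl]; [|move=> [E1|[E1|[E1|[E1|E1]]]]; subst]; lia.
  by rewrite F1 F2 F3 ?orbT.
- have [le3|lt3] := leqP (cyc_val s i 0) (cyc_val s i (2 * b + 2)).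
  + have F1 : first_in i (iota 0 (2 * b + 3)) 0 s.
      by apply: first => [|j jl]; [|move=> [E1|[E1|[E1|[E1|E1]]]]; subst]; lia.
    have F2 : first_in i (iota 1 (2 * b + 2)) (2 * b + 2) s.
      by apply: first => [|j jl]; [|move=> [E1|[E1|[E1|[E1|E1]]]]; subst]; lia.
    have F3 : first_in i (iota 1 (2 * b + 1)) b.+1 s.
      by apply: first => [|j jl]; [|move=> [E1|[E1|[E1|[E1|E1]]]]; subst]; lia.
    by rewrite F1 F2 F3 ?orbT.
  + have F1 : first_in i (iota 0 (2 * b + 3)) (2 * b + 2) s.
      by apply: first => [|j jl]; [|move=> [E1|[E1|[E1|[E1|E1]]]]; subst]; lia.
    have F2 : first_in i (iota 0 (2 * b + 2)) 0 s.
      by apply: first => [|j jl]; [|move=> [E1|[E1|[E1|[E1|E1]]]]; subst]; lia.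
    have F3 : first_in i (iota 1 (2 * b + 1)) b.+1 s.
      by apply: first => [|j jl]; [|move=> [E1|[E1|[E1|[E1|E1]]]]; subst]; lia.
    by rewrite F1 F2 F3 ?orbT.
- have F1 : first_in i (iota 0 (2 * b + 3)) b.+1 s.
    by apply: first => [|j jl]; [|move=> [E1|[E1|[E1|[E1|E1]]]]; subst]; lia.
  have F2 : first_in i (iota 0 b.+1) 0 s.
    by apply: first => [|j jl]; [|move=> [E1|[E1|[E1|[E1|E1]]]]; subst]; lia.
  have F3 : first_in i (iota b.+2 b.+1) (2 * b + 2) s.
    by apply: first => [|j jl]; [|move=> [E1|[E1|[E1|[E1|E1]]]]; subst]; lia.
  by rewrite F1 F2 F3 ?orbT.
- have F1 : first_in i (iota 0 (2 * b + 3)) (2 * b + 2) s.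
    by apply: first => [|j jl]; [|move=> [E1|[E1|[E1|[E1|E1]]]]; subst]; lia.
  have F2 : first_in i (iota 0 (2 * b + 2)) b.+1 s.
    by apply: first => [|j jl]; [|move=> [E1|[E1|[E1|[E1|E1]]]]; subst]; lia.
  have F3 : first_in i (iota 0 b.+1) 0 s.
    by apply: first => [|j jl]; [|move=> [E1|[E1|[E1|[E1|E1]]]]; subst]; lia.
  by rewrite F1 F2 F3 ?orbT.
Qed.

Hypothesis bm : (b < m)%N.

(** The smaller boundary is the minimum of the window and the larger one the
    minimum of the rest. *)
Lemma cyc_window_first s i : (win s i)%:R =
  (pattern b i G 1 s)%:R *
  ((first_in i (iota 0 b.+1) 0 s)%:R * (first_in i (iota 0 b.+2) b.+1 s)%:R +
   c%:R * ((first_in i (iota 1 b.+1) b.+1 s)%:R *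
           (first_in i (iota 0 b.+2) 0 s)%:R)) :> R.
Proof.
rewrite /cyc_window /window add0n -/(pattern b i G 1 s).
set v := cyc_val s i.
have v0 : v 0%N != v b.+1 by apply: cyc_val_neq => //; lia.
have -> : first_in i (iota 0 b.+1) 0 s = all (fun j => v 0 < v j)%N (iota 1 b).
  rewrite /first_in -/v /= leqnn; apply: eq_in_all => j; rewrite mem_iota => jb.
  rewrite ltn_neqAle andb_idl// => _.
  by apply: cyc_val_neq => //; lia.
have -> : first_in i (iota 1 b.+1) b.+1 s =
    all (fun j => v b.+1 < v j)%N (iota 1 b).
  rewrite /first_in iota_rcons all_cat /= leqnn !andbT.
  apply: eq_in_all => j; rewrite mem_iota => jb.
  rewrite ltn_neqAle andb_idl// => _.
  by apply: cyc_val_neq; lia.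
have lt_le x y : all (fun j => v x < v j)%N (iota 1 b) -> (v y < v x)%N ->
    all (fun j => v y <= v j)%N (iota 1 b).
  by move=> h yx; apply: sub_all h => j; lia.
have le_lt x : (x < m.+1)%N -> ~~ (0 < x < b.+1)%N ->
    all (fun j => v x <= v j)%N (iota 1 b) = all (fun j => v x < v j)%N (iota 1 b).
  move=> xm xb; apply: eq_in_all => j; rewrite mem_iota => jb.
  rewrite [RHS]ltn_neqAle andb_idl// => _.
  by apply: cyc_val_neq => //; lia.
have -> : first_in i (iota 0 b.+2) b.+1 s =
    (v b.+1 < v 0)%N && all (fun j => v b.+1 < v j)%N (iota 1 b).
  rewrite /first_in -[iota 0 b.+2]/(0%N :: iota 1 b.+1) iota_rcons /= all_cat /=.
  rewrite leqnn ?andbT ?andTb ?add1n -/v le_lt; [|lia..].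
  by rewrite [X in _ = X && _]ltn_neqAle eq_sym v0.
have -> : first_in i (iota 0 b.+2) 0 s =
    (v 0 < v b.+1)%N && all (fun j => v 0 < v j)%N (iota 1 b).
  rewrite /first_in -[iota 0 b.+2]/(0%N :: iota 1 b.+1) iota_rcons /= all_cat /=.
  rewrite leqnn ?andbT ?andTb ?add1n -/v le_lt; [|lia..].
  by rewrite andbC [X in _ = X && _]ltn_neqAle v0.
move: (all _ _) (all _ _) (pattern _ _ _ _ _) v0 => A B P.
by case: (ltngtP (v 0%N) (v b.+1)) => // _ _; case: A; case: B; case: P; case: c;
  rewrite /= ?(mulr0n, mulr1n, mulr0, mul0r, addr0, add0r, mulr1).
Qed.

(** Taking [H] constant gives the probability of a window; the general case
    says that the window is independent of what happens outside it. *)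
Lemma avg_window i H : blind i (iota 0 b.+2) H ->
  avg (fun s => (win s i)%:R * H s) = window_prob * avg H.
Proof.
move=> HH.
have Hsub lo n : (lo + n <= b.+2)%N -> blind i (iota lo n) H.
  by move=> ln; apply: blind_sub HH => j; rewrite !mem_iota; lia.
pose F1 s : R := (first_in i (iota 0 b.+2) b.+1 s)%:R * H s.
pose F2 s : R := (first_in i (iota 0 b.+2) 0 s)%:R * H s.
transitivity (avg (fun s => (pattern b i G 1 s)%:R *
    ((first_in i (iota 0 b.+1) 0 s)%:R * F1 s +
     c%:R * ((first_in i (iota 1 b.+1) b.+1 s)%:R * F2 s)))).
  by apply: eq_avg => s; rewrite cyc_window_first /F1 /F2; ring.
have bF1 lo n : (lo + n <= b.+1)%N -> blind i (iota lo n) F1.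
  move=> ln; apply: blindM; last by apply: Hsub; lia.
  by apply: blind_first_iota; lia.
have bF2 n : (n <= b.+1)%N -> blind i (iota 1 n) F2.
  move=> ln; apply: blindM; last by apply: Hsub; lia.
  by apply: blind_first_iota; lia.
rewrite avg_pattern; first last.
- have add h h' r : blind i r h -> blind i r h' -> blind i r (fun s => h s + h' s : R).
    by move=> hh hh' t s tr; rewrite hh ?hh'.
  apply: add.
    by apply: blindM; [apply: blind_first_iota; lia|apply: bF1; lia].
  apply: blindM; first exact: blind_cst.
  by apply: blindM; [apply: blind_first_iota; lia|apply: bF2; lia].
- by lia.
rewrite avgD avgZ !avg_first_iota; try by [|lia].
- rewrite /window_prob -!natr1.
  have b0 : (b%:R : R) >= 0 by [].
  by field; do ?[apply/andP; split]; apply/eqP; lra.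
- by apply: bF2.
- by apply: bF1.
Qed.

End WindowBounds.
Section NeighbouringWindows.
Variables (R : realType) (m : nat) (c : bool) (b : nat).
Variable G : pred (bintree unit).
Local Open Scope ring_scope.
Implicit Types (s : 'S_m.+1) (i : 'I_m.+1).

Local Notation p := (shape_prob R b G).
Local Notation win s i := (cyc_window c b G s i).

(** On the cycle of [2 * b + 2] positions two windows share both boundaries. Only
    two nested minima are left, and for right subtrees the boundaries would have
    to be in both orders at once. *)
Lemma avg_window_pair_tight i : m.+1 = (2 * b + 2)%N ->
  avg (fun s => (win s i && win s (cyc_pos i b.+1))%:R : R) <=
  c%:R * (2 * p ^+ 2 / (b%:R + 1) ^+ 2).
Proof.
move=> bN.
have wrap s : cyc_val s i (b.+1 + b).+1 = cyc_val s i 0.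
  rewrite /cyc_val; congr (nat_of_ord (s (_ + _))); apply: val_inj => /=.
  by rewrite (_ : (b.+1 + b).+1 = m.+1) ?modnn ?mod0n//; lia.
case: c => [|]; last first.
  rewrite mul0r -[leRHS](@avg_cst R _ 0 (card_Sn_gt0 m.+1)); apply: le_avg => s.
  case: (boolP (_ && _)) => // /andP[].
  rewrite cyc_window_next => /and4P[_ _ /= w1 _] /and4P[_ _ /= w2 _].
  by move: w1 w2; rewrite add0n wrap; lia.
rewrite mul1r.
pose A s : R :=
  (first_in i (iota 1 (2 * b + 1)) b.+1 s)%:R *
    (first_in i (iota 0 (2 * b + 2)) 0 s)%:R +
  (first_in i (iota 0 b.+1) 0 s)%:R *
    (first_in i (iota 0 (2 * b + 2)) b.+1 s)%:R.
have blindA lo : lo = 1%N \/ lo = b.+2 -> blind i (iota lo b) A.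
  have bl lo1 n1 a1 := @blind_first_iota R m i lo1 n1 lo b a1.
  by move=> lob t s tr; rewrite /A !bl//; lia.
have one lo n a : (lo <= a < lo + n)%N -> (lo + n <= m.+1)%N ->
    avg (fun s => (first_in i (iota lo n) a s)%:R) = n%:R^-1 :> R.
  move=> la ln.
  have := @avg_first_iota R m i lo n a (fun=> 1) la ln (fun _ _ _ => erefl).
  rewrite avg_cst ?card_Sn_gt0// mul1r => <-.
  by apply: eq_avg => s; rewrite mulr1.
pose X := avg (fun s =>
  (pattern b i G 1 s)%:R * ((pattern b i G b.+2 s)%:R * A s)).
suff leX : avg (fun s => (cyc_window true b G s i &&
    cyc_window true b G s (cyc_pos i b.+1))%:R : R) <= X.
  apply: le_trans leX _; rewrite /X.
  rewrite avg_two_patterns; [|lia|by apply: blindA; left|by apply: blindA; right].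
  rewrite [leRHS](_ : _ = p ^+ 2 * (2 * ((b%:R + 1) ^+ 2)^-1)); last by ring.
  rewrite ler_wpM2l ?sqr_ge0// avgD.
  rewrite avg_first_iota; [|lia..|by apply: blind_first_iota; lia].
  rewrite avg_first_iota; [|lia..|by apply: blind_first_iota; lia].
  rewrite !one; [|lia..].
  rewrite (_ : 2 = 1 + 1 :> R); last by lra.
  rewrite mulrDl mul1r lerD// -invfM natr1 -!natrM -natrX lef_pV2 ?posrE ?ltr0n;
    rewrite ?ler_nat ?expn_gt0 ?muln_gt0//; try lia.
apply: le_avg => s; rewrite /A.
case: (boolP (_ && _)) => [/andP[]|_]; last first.
  by rewrite !mulr_ge0 ?addr_ge0// ?mulr_ge0.
rewrite cyc_window_next => /and4P[/allP wx /allP ws _ wp] /and4P[/allP ws' /allP wy _ wp'].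
have -> : pattern b i G 1 s by [].
have -> : pattern b i G b.+2 s by [].
rewrite !mul1r -!natrM -!natrD ler_nat !mulnb.
have first lo n a : (lo + n <= 2 * b + 2)%N ->
    (forall j, (lo <= j < lo + n)%N ->
      (j = 0 \/ j = b.+1 \/
       cyc_val s i 0 < cyc_val s i j /\ cyc_val s i b.+1 < cyc_val s i j)%N ->
      cyc_val s i a <= cyc_val s i j)%N ->
    first_in i (iota lo n) a s.
  move=> ln h; apply/allP => j; rewrite mem_iota => jl; apply: h => //.
  have : (j = 0 \/ j = b.+1 \/ (0 < j <= b) \/ (b.+1 < j <= 2 * b + 1))%N by lia.
  case=> [|[|[jb|jb]]]; [by tauto..| |]; do 2 right.
    by split; [apply: wx|apply: ws]; rewrite mem_iota; lia.
  split; last by apply: ws'; rewrite mem_iota; lia.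
  by rewrite -wrap; apply: wy; rewrite mem_iota; lia.
rewrite !addn_gt0 !lt0b.
have [le1|lt1] := leqP (cyc_val s i 0) (cyc_val s i b.+1).
  have F1 : first_in i (iota 0 (2 * b + 2)) 0 s.
    by apply: first => [|j jl]; [|move=> [E1|[E1|E1]]; subst]; lia.
  have F2 : first_in i (iota 1 (2 * b + 1)) b.+1 s.
    by apply: first => [|j jl]; [|move=> [E1|[E1|E1]]; subst]; lia.
  by rewrite F1 F2.
have F1 : first_in i (iota 0 (2 * b + 2)) b.+1 s.
  by apply: first => [|j jl]; [|move=> [E1|[E1|E1]]; subst]; lia.
have F2 : first_in i (iota 0 b.+1) 0 s.
  by apply: first => [|j jl]; [|move=> [E1|[E1|E1]]; subst]; lia.
by rewrite F1 F2 orbT.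
Qed.

Definition pair_bound : R :=
  if m == (2 * b).+1 then c%:R * (2 * p ^+ 2 / (b%:R + 1) ^+ 2)
  else 5 * p ^+ 2 / (b%:R + 1) ^+ 3.

Lemma cyc_posD i d e : cyc_pos (cyc_pos i d) e = cyc_pos i (d + e).
Proof.
rewrite /cyc_pos -addrA; congr (_ + _).
by apply: val_inj; rewrite /= modnDm.
Qed.

Lemma cyc_pos_full i : cyc_pos i m.+1 = i.
Proof. by rewrite /cyc_pos (_ : inZp m.+1 = 0) ?addr0//; apply: val_inj; rewrite /= modnn. Qed.

Lemma pair_bound_ge0 : 0 <= pair_bound.
Proof.
rewrite /pair_bound; case: ifP => _;
  do ![exact: sqr_ge0|apply: mulr_ge0|rewrite invr_ge0|apply: exprn_ge0|
       apply: addr_ge0|exact: ler0n|exact: ler01].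
Qed.

Definition near_windows i (j : 'I_m.+1) : bool :=
  [exists a : 'I_b.+2, [exists a' : 'I_b.+2, cyc_pos i a == cyc_pos j a']].

Lemma near_windows_refl i : near_windows i i.
Proof. by apply/existsP; exists ord0; apply/existsP; exists ord0. Qed.

Lemma near_windowsP i j : near_windows i j -> i != j ->
  exists2 d, (0 < d < b.+2)%N & j = cyc_pos i d \/ i = cyc_pos j d.
Proof.
case/existsP => a /existsP[a' /eqP E] ij.
have cancel (k l : 'I_m.+1) (e f : nat) : cyc_pos k (e + f) = cyc_pos l f ->
    cyc_pos k e = l.
  by rewrite -cyc_posD => /addIr.
case: (ltngtP a a') => aa.
- exists (a' - a)%N; first by have := ltn_ord a'; lia.
  by right; symmetry; apply: (cancel _ _ _ a); rewrite subnK// ltnW.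
- exists (a - a')%N; first by have := ltn_ord a; lia.
  by left; symmetry; apply: (cancel _ _ _ a'); rewrite subnK// ltnW.
- by case/eqP: ij; apply: (addIr (inZp a)); rewrite -!/(cyc_pos _ a) E aa.
Qed.

Lemma card_near_windows i : (#|[pred j | near_windows i j]| <= 2 * b.+2)%N.
Proof.
pose f (d : 'I_(2 * b.+2)) := cyc_pos i d - inZp b.+2.
have := leq_image_card f predT; rewrite [X in (_ <= X)%N]card_ord.
apply: leq_trans.
apply: subset_leq_card; apply/fintype.subsetP => j; rewrite !inE.
case/existsP => a /existsP[a' /eqP E].
have da : (a + (b.+2 - a') < 2 * b.+2)%N by have := ltn_ord a; lia.
apply/codomP; exists (Ordinal da); rewrite /f /= -cyc_posD E cyc_posD.
by rewrite subnKC ?addrK// ltnW.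
Qed.

Lemma far_window i j t s : ~~ near_windows i j ->
  perm_on (positions i (iota 0 b.+2)) t -> win (t * s)%g j = win s j.
Proof.
move=> far tr.
have fix_ a : (a < b.+2)%N -> cyc_val (t * s)%g j a = cyc_val s j a.
  move=> ab; rewrite /cyc_val permM (out_perm tr)// inE; apply: contra far.
  move=> /mapP[a']; rewrite mem_iota => ab' E; apply/existsP; exists (Ordinal ab').
  by apply/existsP; exists (Ordinal ab); rewrite /= -E.
rewrite /cyc_window /window add0n !fix_//; congr [&& _, _, _ & G _].
- by apply: eq_in_all => a; rewrite mem_iota => ab; rewrite fix_//; lia.
- by apply: eq_in_all => a; rewrite mem_iota => ab; rewrite fix_//; lia.
rewrite -[in RHS](map_id (iota 1 b)) (@cartesian_map (cyc_val (t * s)%g j)).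
  by rewrite bin_shape_map.
by move=> x y; rewrite !mem_iota => xb yb; rewrite !fix_//; lia.
Qed.

Hypothesis bm : (b < m)%N.

Lemma avg_pair_bound i :
  avg (fun s => (win s i && win s (cyc_pos i b.+1))%:R : R) <= pair_bound.
Proof.
rewrite /pair_bound; case: eqP => E; first by apply: avg_window_pair_tight; lia.
have [bN|bN] := leqP (2 * b + 3) m.+1; first exact: avg_window_pair.
(* On a shorter cycle the second window meets the first one again from behind. *)
rewrite (_ : avg _ = 0).
  by have := pair_bound_ge0; rewrite /pair_bound; case: eqP.
rewrite -[RHS](@avg_cst R _ 0 (card_Sn_gt0 m.+1)); apply: eq_avg => s.
case: (boolP (_ && _)) => // /andP[w1 w2]; exfalso.
apply: (@overlapping_windows m c b G s (cyc_pos i b.+1) (m.+1 - b.+1)) => //.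
  by lia.
by rewrite cyc_posD subnKC ?cyc_pos_full//; lia.
Qed.

(** Windows at distance less than [b.+1] exclude each other, so only the two that
    touch at a boundary contribute. *)
Lemma sum_near_pairs i :
  \sum_(j | near_windows i j && (j != i))
    avg (fun s => (win s i && win s j)%:R : R) <= 2 * pair_bound.
Proof.
pose j1 := cyc_pos i b.+1; pose j2 := cyc_pos i (m.+1 - b.+1).
have j2i : cyc_pos j2 b.+1 = i.
  by rewrite /j2 cyc_posD subnK ?cyc_pos_full//; lia.
have pb := pair_bound_ge0.
apply: (@le_trans _ _ (\sum_(j | near_windows i j && (j != i))
    ((j == j1)%:R * pair_bound + (j == j2)%:R * pair_bound))).
  apply: ler_sum => j /andP[nij ji].
  have [->|jj1] := eqVneq j j1.
    by rewrite mul1r (le_trans (avg_pair_bound i))// lerDl mulr_ge0.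
  have [->|jj2] := eqVneq j j2.
    rewrite mul0r add0r mul1r -{1}j2i; under eq_avg do rewrite andbC.
    exact: avg_pair_bound.
  rewrite !mul0r addr0 (_ : avg _ = 0)//.
  rewrite -[RHS](@avg_cst R _ 0 (card_Sn_gt0 m.+1)); apply: eq_avg => s.
  case: (boolP (_ && _)) => // /andP[w1 w2]; exfalso.
  rewrite eq_sym in ji; have [d db Ed] := near_windowsP nij ji.
  have [E|E] := eqVneq d b.+1.
    subst d; case: Ed => [Ej|Ei]; first by rewrite Ej eqxx in jj1.
    case/eqP: jj2; apply: (addIr (inZp b.+1)).
    by rewrite -!/(cyc_pos _ _) j2i.
  case: Ed => [Ej|Ei].
    apply: (@overlapping_windows m c b G s i d) => //; first by lia.
    by rewrite -Ej.
  apply: (@overlapping_windows m c b G s j d) => //; first by lia.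
  by rewrite -Ei.
rewrite big_split /= -!mulr_suml.
have le1 (k : 'I_m.+1) :
    \sum_(j | near_windows i j && (j != i)) (j == k)%:R <= 1 :> R.
  rewrite big_mkcond /= (bigD1 k)//= big1 ?addr0.
    by case: ifP => _; rewrite ?eqxx.
  by move=> j /negPf ->; rewrite if_same.
by rewrite mulr_natl mulr2n lerD// ler_piMl.
Qed.

End NeighbouringWindows.

(** * The Chen-Stein bound for locally dependent indicators *)

Section ChenStein.
Variables (R : realType) (Omega T : finType) (I : T -> Omega -> bool).
Variables (near : rel T) (q beta : R) (K : nat).
Local Open Scope ring_scope.

Definition total (w : Omega) : nat := (\sum_i I i w)%N.
Definition far_total (i : T) (w : Omega) : nat := (\sum_(j | ~~ near i j) I j w)%N.

Hypothesis Omega_gt0 : (0 < #|Omega|)%N.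
Hypothesis near_refl : forall i, near i i.
Hypothesis q_ge0 : 0 <= q.
Hypothesis independence : forall i (h : nat -> R),
  avg (fun w => (I i w)%:R * h (far_total i w)) =
  q * avg (fun w => h (far_total i w)).
Hypothesis card_near : forall i, (#|[pred j | near i j]| <= K)%N.
Hypothesis near_pairs : forall i,
  \sum_(j | near i j && (j != i)) avg (fun w => (I i w && I j w)%:R : R) <= beta.

(** Expand [total w * f (total w)] over the indicators. In the term of [I i] the
    argument is replaced by [far_total i], which is independent of [I i]; this
    costs at most [D] for each indicator near [i] that occurs. *)
Lemma chen_stein (f : nat -> R) (D : R) :
  (forall k, `|f k.+2 - f k.+1| <= D) ->
  `|avg (fun w => #|T|%:R * q * f (total w).+1 - (total w)%:R * f (total w))| <=
  D * (#|T|%:R * (K%:R * q ^+ 2 + beta)).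
Proof.
move=> lipf.
have D0 : 0 <= D by apply: le_trans (normr_ge0 _) (lipf 0%N).
have lip a k : `|f (a + k).+1 - f a.+1| <= D * k%:R.
  elim: k => [|k IHk]; first by rewrite addn0 subrr normr0 mulr0.
  rewrite addnS -natr1 mulrDr mulr1.
  rewrite (_ : _ - _ = (f (a + k).+1 - f a.+1) + (f (a + k).+2 - f (a + k).+1)).
    by rewrite (le_trans (ler_normD _ _))// lerD.
  by ring.
pose near_total i w := (\sum_(j | near i j && (j != i)) I j w)%N.
have split_total i w : total w = (far_total i w + (I i w + near_total i w))%N.
  rewrite /total (bigID (near i)) addnC /=; congr addn.
  by rewrite (bigD1 i)//= near_refl.
pose term i w := q * (f (total w).+1 - f (far_total i w).+1) -
  (I i w)%:R * (f (far_total i w + near_total i w).+1 - f (far_total i w).+1).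
have avg_term i : avg (term i) =
    avg (fun w => q * f (total w).+1 - (I i w)%:R * f (total w)).
  have E0 : avg (fun w => (I i w)%:R * f (far_total i w).+1 -
      q * f (far_total i w).+1) = 0.
    by rewrite avgD avgN (independence i (fun k => f k.+1)) avgZ subrr.
  rewrite -[RHS]addr0 -E0 -avgD; apply: eq_avg => w; rewrite /term.
  case Iw : (I i w); last by rewrite !mul0r; ring.
  by rewrite (split_total i w) Iw add1n addnS; ring.
have bound_term i : `|avg (term i)| <= D * (K%:R * q ^+ 2 + beta).
  have avgI j : avg (fun w => (I j w)%:R) = q.
    have := independence j (fun=> 1); rewrite avg_cst// mulr1 => <-.
    by apply: eq_avg => w; rewrite mulr1.
  apply: le_trans (ler_norm_avg _) _.
  pose g w := D * q * (\sum_(j | near i j) (I j w)%:R) +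
    D * (\sum_(j | near i j && (j != i)) (I i w && I j w)%:R).
  apply: (@le_trans _ _ (avg g)).
    apply: le_avg => w; rewrite /term /g.
    apply: le_trans (ler_normB _ _) _; rewrite !normrM (ger0_norm q_ge0).
    rewrite normr_nat; apply: lerD.
      rewrite [D * q]mulrC -mulrA ler_wpM2l//.
      rewrite (split_total i w) (le_trans (lip _ _))// ler_wpM2l//.
      rewrite -natr_sum ler_nat [leqRHS](bigD1 i)//=.
    case: (I i w); last by rewrite mul0r mulr_ge0 ?sumr_ge0.
    by rewrite mul1r (le_trans (lip _ _))// -natr_sum.
  rewrite /g avgD !avgZ !avg_sum mulrDr lerD//; last by rewrite ler_wpM2l.
  rewrite (eq_bigr _ (fun j _ => avgI j)) sumr_const -mulrA ler_wpM2l//.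
  rewrite -[q *+ _]mulr_natl mulrCA -expr2 ler_wpM2r ?sqr_ge0// ler_nat.
  exact: card_near.
have -> : avg (fun w => #|T|%:R * q * f (total w).+1 - (total w)%:R * f (total w)) =
    \sum_i avg (term i).
  rewrite (eq_bigr _ (fun i _ => avg_term i)) -avg_sum; apply: eq_avg => w.
  rewrite sumrB sumr_const -mulr_suml /total natr_sum.
  by rewrite -[X in _ = X - _]mulr_natl mulrA.
apply: le_trans (ler_norm_sum _ _ _) _.
apply: le_trans (ler_sum _ (fun i _ => bound_term i)) _.
by rewrite sumr_const -[leLHS]mulr_natl mulrCA.
Qed.

End ChenStein.

(** * Stein's equation for the Poisson distribution *)

Section SteinPoisson.
Variables (R : realType) (mu : R).
Local Open Scope ring_scope.
Hypothesis mu_gt0 : 0 < mu.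

Definition pois (k : nat) : R := expR (- mu) * (mu ^+ k / k`!%:R).

Definition pois_cdf (k : nat) : R := \sum_(j < k.+1) pois j.

Lemma pois_gt0 k : 0 < pois k.
Proof. by rewrite mulr_gt0 ?expR_gt0// divr_gt0 ?exprn_gt0// ltr0n fact_gt0. Qed.

Lemma poisS k : k.+1%:R * pois k.+1 = mu * pois k.
Proof.
rewrite /pois exprS factS natrM.
have f0 : k`!%:R != 0 :> R by rewrite pnatr_eq0 -lt0n fact_gt0.
have k0 : 1 + k%:R != 0 :> R by rewrite addrC natr1 pnatr_eq0.
by rewrite -[k.+1%:R]nat1r; field; rewrite f0.
Qed.

Lemma pois_cdfS k : pois_cdf k.+1 = pois_cdf k + pois k.+1.
Proof. by rewrite /pois_cdf big_ord_recr. Qed.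

Lemma pois_cdf_series k :
  pois_cdf k * expR mu = series (exp_coeff mu) k.+1.
Proof.
rewrite /pois_cdf /series /= big_mkord mulr_suml; apply: eq_bigr => j _.
by rewrite /pois mulrAC -expRD addNr expR0 mul1r /exp_coeff.
Qed.

Lemma expR_series : expR mu = limn (series (exp_coeff mu)).
Proof.
rewrite expRE /pseries; congr (limn (series _)); apply/funext => k.
by rewrite /exp_coeff /= mulrC.
Qed.

Lemma pois_cdf_le1 k : pois_cdf k <= 1.
Proof.
rewrite -(ler_pM2r (expR_gt0 mu)) mul1r pois_cdf_series expR_series.
apply: (nondecreasing_cvgn_le _ (is_cvg_series_exp_coeff mu)).
apply: nondecreasing_series => j _ _.
by rewrite /exp_coeff /= divr_ge0 ?exprn_ge0 ?ltW.
Qed.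

Lemma pois_cdf_sup (x : R) : (forall k, pois_cdf k <= x) -> 1 <= x.
Proof.
move=> cx; suff : expR mu <= x * expR mu by rewrite ler_pMl ?expR_gt0.
rewrite [leLHS]expR_series; apply: limr_le; first exact: is_cvg_series_exp_coeff.
exists 1%N => // -[//|n] _ /=.
by rewrite -pois_cdf_series ler_pM2r ?expR_gt0.
Qed.

(** This and the tail estimate compare [mu * pois j], which is
    [j.+1%:R * pois j.+1], with [k.+1%:R * pois j.+1] term by term. They say that
    the lower sums relative to [pois k] increase and the upper ones decrease. *)
Lemma pois_cdf_head k : mu * pois_cdf k <= k.+1%:R * (pois_cdf k.+1 - pois 0).
Proof.
have -> : pois_cdf k.+1 - pois 0 = \sum_(j < k.+1) pois j.+1.
  by rewrite /pois_cdf big_ord_recl /= addrC addKr.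
rewrite /pois_cdf !mulr_sumr; apply: ler_sum => j _.
rewrite -poisS ler_wpM2r ?(ltW (pois_gt0 _))// ler_nat.
exact: ltn_ord.
Qed.

Lemma pois_cdf_tail k : k.+1%:R * (1 - pois_cdf k.+1) <= mu * (1 - pois_cdf k).
Proof.
have step d : k.+1%:R * (pois_cdf (k + d).+1 - pois_cdf k.+1) <=
    mu * (pois_cdf (k + d) - pois_cdf k).
  elim: d => [|d IHd]; first by rewrite addn0 !subrr !mulr0.
  have : k.+1%:R * pois (k + d).+2 <= mu * pois (k + d).+1.
    by rewrite -poisS ler_wpM2r ?(ltW (pois_gt0 _))// ler_nat; lia.
  by rewrite addnS (pois_cdfS (k + d).+1) (pois_cdfS (k + d)) in IHd *; lra.
have k0 : 0 < k.+1%:R :> R by rewrite ltr0n.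
suff : 1 <= pois_cdf k.+1 + mu * (1 - pois_cdf k) / k.+1%:R.
  by rewrite -lerBlDl ler_pdivlMr// mulrC.
apply: pois_cdf_sup => d.
have [dk|kd] := leqP d k.+1.
  apply: (@le_trans _ _ (pois_cdf k.+1)).
    rewrite /pois_cdf -(subnKC dk) -addSn big_split_ord /= lerDl sumr_ge0// => j _.
    exact/ltW/pois_gt0.
  by rewrite lerDl divr_ge0 ?mulr_ge0 ?ler0n ?subr_ge0 ?pois_cdf_le1// ltW.
rewrite -lerBlDl ler_pdivlMr// mulrC.
have := step (d - k.+1)%N; rewrite (_ : (k + (d - k.+1)).+1 = d)%N; last by lia.
by move=> /le_trans; apply; rewrite ler_wpM2l ?(ltW mu_gt0)// lerD2r pois_cdf_le1.
Qed.

(** Stein's equation [mu * f k.+1 - k%:R * f k = chi k - pA], multiplied by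
    [pois k], telescopes because [k%:R * pois k] is [mu * pois k.-1]; this is the
    resulting sum. *)
Definition stein_solution (chi : nat -> bool) (pA : R) (k : nat) : R :=
  (\sum_(j < k) (chi j)%:R * pois j - (\sum_(j < k) pois j) * pA) /
  (mu * pois k.-1).

Lemma stein_equation (chi : nat -> bool) (pA : R) (k : nat) :
  mu * stein_solution chi pA k.+1 - k%:R * stein_solution chi pA k =
  (chi k)%:R - pA.
Proof.
have q0 j : pois j != 0 by rewrite gt_eqF// pois_gt0.
have m0 : mu != 0 by rewrite gt_eqF.
rewrite /stein_solution !big_ord_recr /=; case: k => [|k] /=.
  by rewrite !big_ord0 mul0r subr0 !add0r; field; rewrite m0 q0.
set a := \sum_(j < k.+1) (chi j)%:R * _; set F := \sum_(j < k.+1) _.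
have -> : mu * pois k = k.+1%:R * pois k.+1 by rewrite poisS.
by field; rewrite q0 m0 nat1r pnatr_eq0.
Qed.

(** The step of the solution at [k.+1] is a combination of three terms, of which
    only the middle one is positive; the outer ones are the contributions of the
    points of the set below and above [k.+1]. Passing to the complement changes
    the sign of the solution and gives the bound from below. *)
Lemma stein_solution_lip (chi : nat -> bool) (pA : R) (k : nat) :
  (forall j, \sum_(i < j) (chi i)%:R * pois i <= pA) ->
  (forall j, \sum_(i < j) (~~ chi i)%:R * pois i <= 1 - pA) ->
  `|stein_solution chi pA k.+2 - stein_solution chi pA k.+1| <= Num.min 1 mu^-1.
Proof.
move=> lechi lechiC.
have q0 := pois_gt0 k; have q1 := pois_gt0 k.+1.
(* [a], [e] and [x] are the masses of the set below, at and above [k.+1]. *)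
pose F0 := pois_cdf k; pose F1 := pois_cdf k.+1.
have EF1 : F1 = F0 + pois k.+1 by rewrite /F1 pois_cdfS.
pose a := \sum_(j < k.+1) (chi j)%:R * pois j.
pose e := (chi k.+1)%:R * pois k.+1.
pose r := mu / k.+1%:R.
have k0 : 0 < k.+1%:R :> R by rewrite ltr0n.
have r0 : 0 < r by rewrite divr_gt0.
have sumC n : \sum_(i < n) (~~ chi i)%:R * pois i =
    \sum_(i < n) pois i - \sum_(i < n) (chi i)%:R * pois i.
  rewrite -sumrB; apply: eq_bigr => j _.
  by case: (chi j); rewrite /= ?mul1r ?mul0r ?subrr ?subr0.
have a0 : 0 <= a by apply: sumr_ge0 => j _; rewrite mulr_ge0// ltW// pois_gt0.
have aF : a <= F0.
  apply: ler_sum => j _; have := pois_gt0 j.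
  by case: (chi j); rewrite /= ?mul1r ?mul0r// => /ltW.
have e0 : 0 <= e by rewrite mulr_ge0// ltW.
have eq : e <= pois k.+1.
  by rewrite /e; case: (chi _); rewrite /= ?mul1r ?mul0r// ltW.
pose x := pA - a - e.
have x0 : 0 <= x.
  by have := lechi k.+2; rewrite big_ord_recr /= -/a -/e /x; lra.
have xF : x <= 1 - F1.
  have := lechiC k.+2; rewrite sumC [X in _ - X]big_ord_recr /= -/a -/e.
  by rewrite -/(pois_cdf k.+1) -/F1 /x; lra.
have B1 : (1 - F1) - r * (1 - F0) <= 0.
  rewrite subr_le0 /r mulrAC ler_pdivlMr// mulrC.
  exact: pois_cdf_tail.
have head : r * F0 <= F1 - pois 0.
  by rewrite /r mulrAC ler_pdivrMr// [leRHS]mulrC; exact: pois_cdf_head.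
have B3 : r * F0 - F1 <= 0 by have := pois_gt0 0; lra.
have rq : r * F0 >= 0.
  by rewrite mulr_ge0 ?(ltW r0)//; apply: le_trans aF.
have B2 : (1 - F1) + r * F0 <= Num.min 1 mu.
  rewrite le_min; apply/andP; split; first by have := pois_gt0 0; lra.
  suff : 1 - mu <= pois 0 by lra.
  rewrite /pois expr0 divr1 mulr1.
  exact: expR_ge1Dx.
have E : (mu * pois k.+1) *
    (stein_solution chi pA k.+2 - stein_solution chi pA k.+1) =
    a * ((1 - F1) - r * (1 - F0)) + e * ((1 - F1) + r * F0) + x * (r * F0 - F1).
  rewrite /stein_solution big_ord_recr /= -/a -/e.
  rewrite -/(pois_cdf k.+1) -/F1 -/(pois_cdf k) -/F0 /r.
  have -> : mu * pois k = k.+1%:R * pois k.+1 by rewrite poisS.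
  rewrite /x; field.
  by rewrite !gt_eqF.
have M0 : 0 < Num.min 1 mu by rewrite lt_min ltr01.
have mq : 0 < mu * pois k.+1 by rewrite mulr_gt0.
have EM : Num.min 1 mu^-1 * (mu * pois k.+1) = Num.min 1 mu * pois k.+1.
  rewrite !minr_pMl ?(ltW mq) ?(ltW q1)//.
  by rewrite !mul1r mulKf ?gt_eqF// minC.
rewrite -(ler_pM2r mq) EM -[X in _ * X <= _]gtr0_norm// -normrM mulrC E.
move: (Num.min 1 mu) B2 M0 => M B2 M0.
(* Stated for arbitrary masses, to be used for the set and its complement. *)
have upper (a' e' x' : R) : 0 <= a' -> 0 <= e' <= pois k.+1 -> 0 <= x' ->
    a' * ((1 - F1) - r * (1 - F0)) + e' * ((1 - F1) + r * F0) +
    x' * (r * F0 - F1) <= M * pois k.+1.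
  move=> a'0 /andP[e'0 e'q] x'0.
  have h1 : a' * ((1 - F1) - r * (1 - F0)) <= 0 by rewrite mulr_ge0_le0.
  have h3 : x' * (r * F0 - F1) <= 0 by rewrite mulr_ge0_le0.
  have h2 : e' * ((1 - F1) + r * F0) <= pois k.+1 * M.
    apply: ler_pM => //.
    by have := pois_cdf_le1 k.+1; rewrite -/F1; lra.
  by lra.
rewrite ler_norml upper ?e0 ?eq// andbT.
have := upper (F0 - a) (pois k.+1 - e) (1 - F1 - x).
rewrite !subr_ge0 => /(_ aF _ xF).
rewrite eq lerBlDr lerDl e0 => /(_ isT).
suff : F0 * ((1 - F1) - r * (1 - F0)) + pois k.+1 * ((1 - F1) + r * F0) +
  (1 - F1) * (r * F0 - F1) = 0 by lra.
by rewrite EF1; ring.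
Qed.

End SteinPoisson.

(** * Total variation distance and the discrete probabilities *)

Section TotalVariation.
Variable R : realType.
Local Open Scope classical_set_scope.
Local Open Scope ring_scope.
Local Open Scope ereal_scope.

Lemma measure_nat_series (m : {measure set nat -> \bar R}) (A : set nat) :
  m A = \sum_(0 <= l <oo | l \in A) m [set l].
Proof.
rewrite -(measure_bigcup m A (fun l => [set l])) //.
- congr (m _); apply/seteqP; split=> [x Ax|x [l Al ->]] //.
  by exists x.
- by move=> i j _ _ [x [-> ->]].
Qed.

Lemma nneseriesC (c : nat -> \bar R) (A : set nat) : (forall l, 0 <= c l) ->
  \sum_(0 <= l <oo) c l =
  \sum_(0 <= l <oo | l \in A) c l + \sum_(0 <= l <oo | l \in ~` A) c l.
Proof.
move=> c0; rewrite [X in _ = X + _]eseries_mkcond [X in _ = _ + X]eseries_mkcond.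
rewrite -nneseriesD; first last.
- by move=> l _ _; case: ifP.
- by move=> l _ _; case: ifP.
apply: eq_eseriesr => l _; rewrite in_setC.
by case: (l \in A); rewrite ?adde0 ?add0e.
Qed.

(** The supremum is attained at the set of points where the first measure puts
    more mass, and there the two halves of the sum agree. *)
Lemma dTV_half_sum (m1 m2 : probability nat R) :
  dTV m1 m2 =
  (2^-1)%:E * \sum_(0 <= l <oo) `|m1 [set l] - m2 [set l]|.
Proof.
have fin (m : probability nat R) A : m A \is a fin_num by apply: fin_num_measure.
pose c l := `|m1 [set l] - m2 [set l]|.
have c0 l : 0 <= c l by apply: abse_ge0.
pose C (A : set nat) := \sum_(0 <= l <oo | l \in A) c l.
have series_add (b : probability nat R) A :
    b A + C A = \sum_(0 <= l <oo | l \in A) (b [set l] + c l).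
  by rewrite measure_nat_series -nneseriesD.
have CT A : \sum_(0 <= l <oo) c l = C A + C (~` A) by apply: nneseriesC.
have C_ge0 A : 0 <= C A by apply: nneseries_ge0.
have m_setC (m : probability nat R) A : m (~` A) = 1 - m A.
  exact: probability_setC.
have le12 l : m1 [set l] <= m2 [set l] + c l.
  by rewrite /c -leeBlDl ?fin// lee_abs.
have le21 l : m2 [set l] <= m1 [set l] + c l.
  rewrite /c; move: (fin m1 [set l]) (fin m2 [set l]).
  case: (m1 _) => // x _; case: (m2 _) => // y _.
  by rewrite -EFinB abse_EFin -EFinD lee_fin -lerBlDl distrC ler_norm.
have half_le A : m1 A - m2 A <= (2^-1)%:E * \sum_(0 <= l <oo) c l.
  have hA : m1 A <= m2 A + C A.
    rewrite series_add [leLHS]measure_nat_series.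
    by apply: lee_nneseries => [l _ _|l _]; [exact: measure_ge0|exact: le12].
  have hC : m2 (~` A) <= m1 (~` A) + C (~` A).
    rewrite series_add [leLHS]measure_nat_series.
    by apply: lee_nneseries => [l _ _|l _]; [exact: measure_ge0|exact: le21].
  rewrite (CT A); move: hA hC (C_ge0 A) (C_ge0 (~` A)); rewrite !m_setC.
  have := fin m1 A; case: (m1 A) => // x _.
  have := fin m2 A; case: (m2 A) => // y _.
  case: (C A) => [u| |] //; case: (C (~` A)) => [v| |] //; rewrite ?lee_fin.
  - by move=> h1 h2 h3 h4; lra.
  - by move=> _ _ _ _; rewrite addey// gt0_muley ?leey// lte_fin invr_gt0.
  - by move=> _ _ _ _; rewrite addye// gt0_muley ?leey// lte_fin invr_gt0.
  - by move=> _ _ _ _; rewrite addye// gt0_muley ?leey// lte_fin invr_gt0.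
pose A := [set l | m2 [set l] < m1 [set l]].
have half_eq : m1 A - m2 A = (2^-1)%:E * \sum_(0 <= l <oo) c l.
  have hA : m1 A = m2 A + C A.
    rewrite series_add [LHS]measure_nat_series; apply: eq_eseriesr => l lA.
    rewrite inE /A /= in lA; move: lA.
    suff : m2 [set l] < m1 [set l] -> m1 [set l] = m2 [set l] + c l by [].
    rewrite /c.
    move: (fin m1 [set l]) (fin m2 [set l]).
    case: (m1 _) => // x _; case: (m2 _) => // y _; rewrite lte_fin => yx.
    by rewrite -EFinB abse_EFin -EFinD gtr0_norm ?subr_gt0//; congr (_%:E); ring.
  have hC : m2 (~` A) = m1 (~` A) + C (~` A).
    rewrite series_add [LHS]measure_nat_series; apply: eq_eseriesr => l lA.
    rewrite inE /A /= in lA; move: lA => /negP; rewrite -leNgt.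
    suff : m1 [set l] <= m2 [set l] -> m2 [set l] = m1 [set l] + c l by [].
    rewrite /c.
    move: (fin m1 [set l]) (fin m2 [set l]).
    case: (m1 _) => // x _; case: (m2 _) => // y _; rewrite lee_fin => yx.
    by rewrite -EFinB abse_EFin -EFinD ler0_norm ?subr_le0//; congr (_%:E); ring.
  rewrite (CT A); move: hA hC (C_ge0 A) (C_ge0 (~` A)); rewrite !m_setC.
  have := fin m1 A; case: (m1 A) => // x _.
  have := fin m2 A; case: (m2 A) => // y _.
  case: (C A) => [u| |] //; case: (C (~` A)) => [v| |] //=.
  by move=> [h1] [h2] _ _; congr (_%:E); lra.
apply/eqP; rewrite eq_le; apply/andP; split.
  apply: ge_ereal_sup => _ [B _ <-].
  suff : `|m1 B - m2 B| <= (2^-1)%:E * \sum_(0 <= l <oo) c l by [].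
  have := half_le B; have := half_le (~` B); rewrite !m_setC.
  have := fin m1 B; case: (m1 B) => // x _.
  have := fin m2 B; case: (m2 B) => // y _.
  case: (\sum_(0 <= l <oo) c l) => [u| |] //; rewrite ?lee_fin.
  - move=> h1 h2; suff : (`|x - y| <= 2^-1 * u)%R by [].
    by rewrite ler_norml; apply/andP; split; lra.
  - by move=> _ _; rewrite gt0_muley ?leey// lte_fin invr_gt0.
  - by rewrite gt0_muleNy ?lte_fin ?invr_gt0.
rewrite -half_eq; apply: (@le_trans _ _ `|m1 A - m2 A|); first exact: lee_abs.
by apply: ereal_sup_ubound; exists A.
Qed.

End TotalVariation.

Section UniformFinite.
Variables (R : realType) (T : finType) (t0 : T).
Local Open Scope classical_set_scope.
Local Open Scope ring_scope.

Lemma uniform_finE (A : set (discr t0)) :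
  @uniform_fin R T t0 A = (avg (fun x : T => (`[< A x >])%:R))%:E.
Proof.
rewrite /uniform_fin /avg -natr_sum -sum1_card big_mkcond /=.
by congr ((_%:R / _)%:E); apply: eq_bigr => x _; case: asboolP.
Qed.

Lemma uniform_expectation (X : discr t0 -> nat) :
  ('E_(@uniform_fin R T t0)[fun x => (X x)%:R] =
   (avg (fun x : T => (X x)%:R))%:E)%E.
Proof.
rewrite unlock.
transitivity (\int[@uniform_fin R T t0]_x
    (\sum_(y <- enum T) (X y)%:R%:E * (\1_[set (y : discr t0)] x)%:E))%E.
  apply: eq_integral => x _.
  rewrite (bigD1_seq (x : T)) ?enum_uniq ?mem_enum//= indicE mem_set// mule1.
  rewrite big1 ?adde0// => y yx; rewrite indicE memNset ?mule0// => xy.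
  by rewrite xy eqxx in yx.
have mass (y : T) : (\int[@uniform_fin R T t0]_x (\1_[set (y : discr t0)] x)%:E =
    (#|T|%:R^-1)%:E)%E.
  rewrite integral_indic// setIT.
  transitivity (@uniform_fin R T t0 [set (y : discr t0)]); first by [].
  rewrite uniform_finE /avg (bigD1 y)//= big1 => [|x /eqP xy]; last by rewrite asboolF.
  by rewrite addr0 asboolT// mul1r.
rewrite ge0_integral_sum//.
rewrite (eq_bigr (fun y : T => ((X y)%:R / #|T|%:R)%:E)); last first.
  by move=> y _; rewrite ge0_integralZl_EFin// mass -EFinM.
by rewrite sumEFin /avg mulr_suml big_enum.
Qed.

End UniformFinite.

(** * Poisson approximation of window counts *)

Section PoissonMeasure.
Variables (R : realType) (mu : R).
Local Open Scope classical_set_scope.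
Local Open Scope ring_scope.

Lemma PoE A : Po mu A = (if (0 < mu)%R then \esum_(k in A) (poisson_pmf mu k)%:E
  else \d_0%N A)%E.
Proof. by []. Qed.

Lemma Po_point l : 0 <= mu -> Po mu [set l] = (pois mu l)%:E.
Proof.
rewrite PoE le_eqVlt => /predU1P[<-|mu0].
  rewrite ltxx diracE /pois oppr0 expR0 mul1r expr0n.
  case: l => [|l]; first by rewrite fact0 divr1 mem_set.
  by rewrite mul0r memNset.
rewrite mu0 esum_set1 ?lee_fin ?poisson_pmf_ge0// /poisson_pmf mu0 /pois.
by rewrite mulrC.
Qed.

Definition Po_fine (A : set nat) : R := fine (Po mu A).

Lemma Po_fineK A : Po mu A = (Po_fine A)%:E.
Proof. by rewrite /Po_fine fineK// fin_num_measure. Qed.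

Lemma Po_fineC A : Po_fine (~` A) = 1 - Po_fine A.
Proof.
apply: EFin_inj; rewrite -Po_fineK EFinB -Po_fineK.
exact: probability_setC.
Qed.

Lemma sum_pois_le (A : set nat) (n : nat) : 0 <= mu ->
  \sum_(j < n) (`[< A j >])%:R * pois mu j <= Po_fine A.
Proof.
move=> mu0.
have E : Po mu (A `&` [set j | (j < n)%N]) =
    (\sum_(j < n) (`[< A j >])%:R * pois mu j)%:E.
  elim: n => [|n IHn].
    rewrite big_ord0 (_ : _ `&` _ = set0) ?measure0//.
    by apply/seteqP; split => // j [].
  rewrite big_ord_recr /= EFinD -IHn.
  have [An|An] := pselect (A n).
    rewrite asboolT// mul1r -Po_point// -measureU//; last first.
      by apply/seteqP; split => // j /= [[_ jn] E]; move: jn; rewrite E ltnn.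
    congr (Po mu _); apply/seteqP; split => j /=.
      move=> [Aj]; rewrite ltnS leq_eqVlt => /predU1P[->|jn]; first by right.
      by left.
    by move=> [[Aj jn]|->]; split=> //; exact: ltnW.
  rewrite asboolF// mul0r adde0; congr (Po mu _); apply/seteqP; split => j /=.
    by move=> [Aj]; rewrite ltnS leq_eqVlt => /predU1P[jn|//]; rewrite -jn in An.
  by move=> [Aj jn]; split=> //; exact: ltnW.
rewrite -lee_fin -E -Po_fineK; apply: le_measure; rewrite ?inE//.
Qed.

End PoissonMeasure.

Section CyclicPoisson.
Variables (R : realType) (m : nat) (c : bool) (b : nat).
Variable G : pred (bintree unit).
Local Open Scope ring_scope.
Hypothesis bm : (b < m)%N.

Local Notation q := (window_prob R c b G).
Local Notation X := (@cyc_count m c b G).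

Definition cyc_mean : R := m.+1%:R * q.

Lemma shape_prob_ge0 : 0 <= shape_prob R b G.
Proof. exact: avg_ge0. Qed.

Lemma window_prob_ge0 : 0 <= q.
Proof.
rewrite /window_prob; have := shape_prob_ge0 => p0.
by apply: divr_ge0; apply: mulr_ge0 => //; apply: addr_ge0.
Qed.

Lemma avg_cyc_window (i : 'I_m.+1) : avg (fun s => (cyc_window c b G s i)%:R) = q.
Proof.
have := @avg_window R m c b G bm i (fun=> 1) (fun _ _ _ => erefl).
rewrite avg_cst ?card_Sn_gt0// mulr1 => <-.
by apply: eq_avg => s; rewrite mulr1.
Qed.

Lemma avg_cyc_total : avg (fun s => (X s)%:R) = cyc_mean.
Proof.
rewrite /cyc_count; under eq_avg do rewrite natr_sum.
rewrite avg_sum (eq_bigr _ (fun i _ => avg_cyc_window i)) sumr_const card_ord.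
by rewrite -[LHS]mulr_natl.
Qed.

Lemma cyc_mean_ge0 : 0 <= cyc_mean.
Proof. by rewrite mulr_ge0 ?window_prob_ge0. Qed.

(** Each window has at most [2 * b.+2] near ones, and two that touch it. *)
Definition stein_error : R :=
  m.+1%:R * ((2 * b.+2)%:R * q ^+ 2 + 2 * pair_bound R m c b G).

(** For [cyc_mean = 0] both sides vanish, the inverse of 0 being 0. *)
Lemma cyc_poisson (A : set nat) :
  `|avg (fun s => (`[< A (X s) >])%:R) - Po_fine cyc_mean A| <=
  Num.min 1 cyc_mean^-1 * stein_error.
Proof.
have [mu0|mu0] := eqVneq cyc_mean 0.
  have X0 s : X s = 0%N.
    have : \sum_s (X s)%:R = 0 :> R.
      apply/eqP; have /eqP := avg_cyc_total.
      by rewrite mu0 /avg mulf_eq0 invr_eq0 pnatr_eq0 -[_ == 0%N]negbK -lt0n card_Sn_gt0 orbF.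
    move=> /eqP; rewrite psumr_eq0// => /allP/(_ s).
    by rewrite mem_index_enum pnatr_eq0 => /(_ isT)/eqP.
  rewrite mu0 invr0 (_ : Num.min 1 0 = 0 :> R); last by rewrite min_r.
  rewrite mul0r normr_le0 subr_eq0.
  under eq_avg do rewrite X0.
  rewrite avg_cst ?card_Sn_gt0//; apply/eqP/EFin_inj.
  by rewrite -Po_fineK PoE ltxx diracE; case: asboolP => A0;
    [rewrite mem_set|rewrite memNset].
have mu_gt0 : 0 < cyc_mean by rewrite lt_neqAle eq_sym mu0 cyc_mean_ge0.
pose chi k := `[< A k >].
pose pA := Po_fine cyc_mean A.
pose f := stein_solution cyc_mean chi pA.
have -> : avg (fun s => (`[< A (X s) >])%:R) - pA =
    avg (fun s => #|'I_m.+1|%:R * q * f (X s).+1 - (X s)%:R * f (X s)).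
  rewrite -(@avg_cst R _ pA (card_Sn_gt0 m.+1)) -avgN -avgD; apply: eq_avg => s.
  by rewrite card_ord -/cyc_mean /f stein_equation.
have := @chen_stein R _ _ (fun i s => cyc_window c b G s i)
  (@near_windows m b) q (2 * pair_bound R m c b G) (2 * b.+2) (card_Sn_gt0 m.+1)
  (@near_windows_refl m b) window_prob_ge0 _ (@card_near_windows m b)
  (sum_near_pairs R c G bm) f (Num.min 1 cyc_mean^-1).
rewrite /total card_ord; apply.
  move=> i h; apply: avg_window => // t s tr; congr h.
  by rewrite /far_total; apply: eq_bigr => j far; rewrite (far_window c G s far tr).
move=> k; apply: stein_solution_lip => // j.
  by apply: sum_pois_le; exact: cyc_mean_ge0.
rewrite /pA -Po_fineC; apply: le_trans (sum_pois_le _ _ cyc_mean_ge0).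
apply: ler_sum => l _; rewrite /chi.
have -> : `[< (~` A)%classic l >] = ~~ `[< A l >]; last by [].
by apply/idP/idP => [/asboolP nA|/asboolP nA]; apply/asboolP.
Qed.

End CyclicPoisson.

(** * Transfer to the two random trees *)

Section ErrorBounds.
Variables (R : realType) (m : nat) (c : bool) (b : nat).
Variable G : pred (bintree unit).
Local Open Scope ring_scope.

Local Notation p := (shape_prob R b G).
Local Notation mu := (cyc_mean R m c b G).

Lemma shape_prob_le1 : p <= 1.
Proof.
rewrite -[leRHS](@avg_cst R _ 1 (card_Sn_gt0 b)); apply: le_avg => u.
by case: (G _).
Qed.

(** Relative to [mu], the products of probabilities contribute at most
    [4 * p / (b + 1)] and the pairs at most [20 * p / (b + 1)]. *)
Lemma stein_error_le : c && (m == (2 * b).+1) = false ->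
  stein_error R m c b G <= 24 * (p / (b%:R + 1) * mu).
Proof.
move=> cm; have p0 := shape_prob_ge0 R b G.
have b1 : 1 <= b%:R + 1 :> R by rewrite lerDr.
have x0 : 0 < b%:R + 1 :> R by lra.
pose x : R := b%:R + 1; rewrite -/x in b1 x0 *.
have px3 : 0 <= p ^+ 2 / x ^+ 3 := divr_ge0 (sqr_ge0 _) (exprn_ge0 _ (ltW x0)).
have px : 0 <= p / x := divr_ge0 p0 (ltW x0).
have pair_le : pair_bound R m c b G <= 5 * p ^+ 2 / x ^+ 3.
  rewrite /pair_bound; case: eqP => [E|_]; last exact: lexx.
  move: cm; rewrite E eqxx andbT => ->; rewrite mul0r.
  by rewrite -mulrA mulr_ge0.
rewrite /stein_error /cyc_mean (_ : 24 * _ =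
    m.+1%:R * (24 * (p / x) * window_prob R c b G)); last by ring.
rewrite ler_wpM2l//.
have -> : (2 * b.+2)%:R = 2 * (x + 1) :> R.
  by rewrite natrM /x -!natr1; ring.
have qE : window_prob R c b G = (1 + c%:R) * p / (x * (x + 1)).
  by rewrite /window_prob /x; congr (_ / (_ * _)); ring.
have c1 : 1 <= 1 + c%:R :> R by rewrite lerDl.
have c2 : 1 + c%:R <= 2 :> R by case: c => /=; lra.
have x10 : 0 < x + 1 by lra.
have h1 : 2 * (x + 1) * window_prob R c b G ^+ 2 <=
    4 * (p / x) * window_prob R c b G.
  rewrite expr2 mulrA ler_wpM2r ?window_prob_ge0//.
  rewrite qE (_ : 2 * (x + 1) * _ = (2 * (1 + c%:R)) * (p / x)); last first.
    by field; rewrite !gt_eqF.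
  by rewrite ler_wpM2r//; lra.
have h2 : 2 * (5 * p ^+ 2 / x ^+ 3) <= 20 * (p / x) * window_prob R c b G.
  rewrite qE.
  rewrite (_ : 20 * (p / x) * _ = (20 * (1 + c%:R) * x / (x + 1)) * (p ^+ 2 / x ^+ 3)).
    rewrite (_ : 2 * _ = 10 * (p ^+ 2 / x ^+ 3)); last by ring.
    rewrite ler_wpM2r//.
    by rewrite ler_pdivlMr//; nra.
  by field; rewrite !gt_eqF.
lra.
Qed.

Lemma stein_error_tight_le : c = true -> m = (2 * b).+1 -> (0 < b)%N ->
  stein_error R m c b G <= 24 * (p ^+ 2 / b%:R).
Proof.
move=> c1 mE b0; rewrite /stein_error /pair_bound /window_prob c1 mE eqxx.
rewrite (_ : (nat_of_bool true)%:R = 1 :> R)//.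
set y : R := b%:R.
have y1 : 1 <= y by rewrite /y (ler_nat _ 1).
have -> : (2 * b).+2%:R = 2 * (y + 1) :> R by rewrite -!natr1 natrM /y; ring.
have -> : (2 * b.+2)%:R = 2 * (y + 2) :> R by rewrite natrM /y -!natr1; ring.
rewrite (_ : 2 * (y + 1) * _ = (16 * y / ((y + 1) * (y + 2)) + 8 * y / (y + 1)) *
  (p ^+ 2 / y)); last by field; rewrite !gt_eqF//; lra.
have y0 : 0 <= y by lra.
rewrite ler_wpM2r ?(divr_ge0 (sqr_ge0 _) y0)//.
have h1 : 16 * y / ((y + 1) * (y + 2)) <= 16.
  by rewrite ler_pdivrMr; nra.
have h2 : 8 * y / (y + 1) <= 8 by rewrite ler_pdivrMr; lra.
lra.
Qed.

End ErrorBounds.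

Section Laws.
Variable R : realType.
Local Open Scope classical_set_scope.
Local Open Scope ring_scope.

Definition tree_pred (P : set (bintree unit)) : pred (bintree unit) :=
  fun t => `[< P t >].

Definition forest_pred (P : set (otree unit)) : pred (bintree unit) :=
  fun t => `[< P (ONode tt (forest t)) >].

Lemma bij_invg n : bijective (fun s : 'S_n => s^-1%g).
Proof. by exists (fun s => s^-1%g); exact: invgK. Qed.

Lemma bst_law n k P (h : nat -> R) : (1 <= k < n)%N ->
  avg (fun s : 'S_n => h (bst_count k P (s : bst_space n))) =
  avg (fun s : 'S_n.+1 => h (cyc_count true k (tree_pred P) s)).
Proof.
move=> /andP[k0 kn]; rewrite avg_cyc_count// -[RHS](avg_bij _ (@bij_invg n)).
apply: eq_avg => s; congr h.
by rewrite /bst_count count_bin_subtrees// bst_perm_shape.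
Qed.

Lemma bst_p_shape_prob k P : bst_p R k P = shape_prob R k (tree_pred P).
Proof.
rewrite /shape_prob -(avg_bij _ (@bij_invg k)) /bst_p.
transitivity (fine (@uniform_fin R _ (1%g : 'S_k) [set s | P (bst s)])); first by [].
rewrite uniform_finE /=; apply: eq_avg => s.
by rewrite -bst_perm_shape.
Qed.

Lemma rrt_law n k P (h : nat -> R) : (1 <= k < n)%N ->
  avg (fun f : rrt_choice n => h (rrt_count k P (f : rrt_space n))) =
  avg (fun s : 'S_n.-1.+1 => h (cyc_count false k.-1 (forest_pred P) s)).
Proof.
move=> /andP[k0 kn]; rewrite avg_cyc_count; last by lia.
have [phi [bphi phiE]] := rrt_perm_bij n.
rewrite -[RHS](avg_bij _ bphi); apply: eq_avg => f; congr h.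
rewrite /rrt_count phiE /= otree_size_forest bin_size_shape.
rewrite inorder_cartesian size_iota.
have -> : (n.-1.+1 == k) = false by lia.
by rewrite add0n (count_otree_subtrees (fun t => `[< P t >])).
Qed.

Lemma rrt_p_shape_prob k P : rrt_p R k P = shape_prob R k.-1 (forest_pred P).
Proof.
have [phi [bphi phiE]] := rrt_perm_bij k.
rewrite /shape_prob -(avg_bij _ bphi) /rrt_p.
transitivity (fine (@uniform_fin R _ (rrt_choice0 k) [set f | P (rrt f)])); first by [].
rewrite uniform_finE /=; apply: eq_avg => f.
by rewrite /forest_pred -phiE.
Qed.

Lemma dTV_window_count (T : finType) (t0 : T) (X : {mfun discr t0 >-> nat})
    m c b G : (b < m)%N ->
  (forall h : nat -> R, avg (fun x : T => h (X x)) =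
    avg (fun s : 'S_m.+1 => h (cyc_count c b G s))) ->
  (dTV (distribution (@uniform_fin R T t0) X) (Po (cyc_mean R m c b G)) <=
  (Num.min 1 (cyc_mean R m c b G)^-1 * stein_error R m c b G)%:E)%E.
Proof.
move=> bm law; apply: ge_ereal_sup => _ [A _ <-].
suff : (`|distribution (@uniform_fin R T t0) X A - Po (cyc_mean R m c b G) A| <=
  (Num.min 1 (cyc_mean R m c b G)^-1 * stein_error R m c b G)%:E)%E by [].
have -> : distribution (@uniform_fin R T t0) X A =
    (avg (fun s : 'S_m.+1 => (`[< A (cyc_count c b G s) >])%:R))%:E.
  rewrite -(law (fun k => (`[< A k >])%:R)).
  transitivity (@uniform_fin R T t0 (X @^-1` A)); first by [].
  by rewrite uniform_finE.
rewrite Po_fineK -EFinB abse_EFin lee_fin.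
exact: cyc_poisson.
Qed.

Lemma dTV_count_half_sum (T : finType) (t0 : T) (X : {mfun discr t0 >-> nat})
    (mu : R) : 0 <= mu ->
  (dTV (distribution (@uniform_fin R T t0) X) (Po mu) =
   (2^-1)%:E * \sum_(0 <= l <oo)
     `|@uniform_fin R T t0 [set x | X x = l] -
       (expR (- mu) * (mu ^+ l / l`!%:R))%:E|)%E.
Proof.
move=> mu0; rewrite dTV_half_sum; congr (_ * _)%E; apply: eq_eseriesr => l _.
by rewrite Po_point.
Qed.

Lemma bst_expectation n k P : (1 <= k < n)%N ->
  ('E_(bst_prob R n)[fun s => (bst_count k P s)%:R] =
   (cyc_mean R n true k (tree_pred P))%:E)%E.
Proof.
move=> kn; rewrite /bst_prob uniform_expectation -avg_cyc_total; last by case/andP: kn.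
by rewrite -bst_law.
Qed.

Lemma rrt_expectation n k P : (1 <= k < n)%N ->
  ('E_(rrt_prob R n)[fun f => (rrt_count k P f)%:R] =
   (cyc_mean R n.-1 false k.-1 (forest_pred P))%:E)%E.
Proof.
move=> kn; rewrite /rrt_prob uniform_expectation -avg_cyc_total; last by lia.
by rewrite -rrt_law.
Qed.

End Laws.

(** * Bounds for the two random trees *)

Section Bounds.
Variable R : realType.
Local Open Scope classical_set_scope.
Local Open Scope ring_scope.

(** The two branches of the factor of Stein's method give the two cases of the
    bound. *)
Lemma min_inv_bound (mu x e : R) : 0 <= mu -> 0 <= x -> e <= 24 * (x * mu) ->
  (1 <= mu -> Num.min 1 mu^-1 * e <= 24 * x) /\
  (mu < 1 -> Num.min 1 mu^-1 * e <= 24 * (x * mu)).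
Proof.
move=> mu0 x0 ex; have min0 : 0 <= Num.min 1 mu^-1 by rewrite le_min ler01 invr_ge0.
have le1 : Num.min 1 mu^-1 * e <= Num.min 1 mu^-1 * (24 * (x * mu)).
  by rewrite ler_wpM2l.
split=> mu1; apply: le_trans le1 _.
  rewrite (_ : 24 * x = mu^-1 * (24 * (x * mu))); last by field; lra.
  by rewrite ler_wpM2r ?ge_min ?lexx ?orbT// !mulr_ge0.
by rewrite -[leRHS]mul1r ler_wpM2r ?ge_min ?lexx// !mulr_ge0.
Qed.

Lemma bst_mean_cyc n k P : (1 <= k < n)%N ->
  bst_mean R n k P = cyc_mean R n true k (tree_pred P).
Proof. by move=> kn; rewrite /bst_mean bst_expectation. Qed.

Lemma rrt_mean_cyc n k P : (1 <= k < n)%N ->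
  rrt_mean R n k P = cyc_mean R n.-1 false k.-1 (forest_pred P).
Proof. by move=> kn; rewrite /rrt_mean rrt_expectation. Qed.

Lemma bst_dTV_bound n k P : (1 <= k < n)%N ->
  let p := bst_p R k P in
  let mu := bst_mean R n k P in
  let d := dTV (distribution (bst_prob R n) (@bst_count n k P)) (Po mu) in
  (n <> (2 * k + 1)%N ->
     (1 <= mu -> (d <= (24 * (p / k%:R))%:E)%E) /\
     (mu < 1 -> (d <= (24 * (p / k%:R * mu))%:E)%E)) /\
  (n = (2 * k + 1)%N -> (d <= (24 * (p ^+ 2 / k%:R))%:E)%E).
Proof.
move=> kn p mu d; have [k0 ltkn] := andP kn.
have mu0 : 0 <= mu by rewrite /mu bst_mean_cyc// cyc_mean_ge0.
have p0 : 0 <= p by rewrite /p bst_p_shape_prob shape_prob_ge0.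
have k1 : 0 < k%:R :> R by rewrite ltr0n.
have pk : 0 <= p / k%:R by rewrite divr_ge0// ltW.
have dle : (d <= (Num.min 1 mu^-1 * stein_error R n true k (tree_pred P))%:E)%E.
  rewrite /d /mu bst_mean_cyc//; apply: dTV_window_count => // h.
  exact: bst_law.
split=> nk.
  have [|h1 h2] := @min_inv_bound mu (p / k%:R)
      (stein_error R n true k (tree_pred P)) mu0 pk.
    have ck : true && (n == (2 * k).+1) = false by lia.
    apply: le_trans (stein_error_le R (tree_pred P) ck) _.
    rewrite -bst_p_shape_prob -bst_mean_cyc// -/p -/mu.
    rewrite ler_wpM2l// ler_wpM2r// ler_wpM2l// lef_pV2 ?posrE//; lra.
  by split=> hmu; apply: le_trans dle _; rewrite lee_fin; [exact: h1|exact: h2].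
apply: le_trans dle _; rewrite lee_fin.
have E0 : 0 <= stein_error R n true k (tree_pred P).
  rewrite mulr_ge0// addr_ge0// mulr_ge0 ?sqr_ge0//.
  exact: pair_bound_ge0.
(* Here the factor 1 of Stein's method suffices. *)
apply: (@le_trans _ _ (stein_error R n true k (tree_pred P))).
  by rewrite -[leRHS]mul1r ler_wpM2r// ge_min lexx.
rewrite /p bst_p_shape_prob; apply: stein_error_tight_le => //.
by rewrite nk addn1.
Qed.

Lemma rrt_dTV_bound n k P : (1 <= k < n)%N ->
  let p := rrt_p R k P in
  let mu := rrt_mean R n k P in
  let d := dTV (distribution (rrt_prob R n) (@rrt_count n k P)) (Po mu) in
  (1 <= mu -> (d <= (24 * (p / k%:R))%:E)%E) /\
  (mu < 1 -> (d <= (24 * (p / k%:R * mu))%:E)%E).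
Proof.
move=> kn p mu d; have [k0 ltkn] := andP kn.
have mu0 : 0 <= mu by rewrite /mu rrt_mean_cyc// cyc_mean_ge0.
have p0 : 0 <= p by rewrite /p rrt_p_shape_prob shape_prob_ge0.
have pk : 0 <= p / k%:R by rewrite divr_ge0.
have dle : (d <= (Num.min 1 mu^-1 *
    stein_error R n.-1 false k.-1 (forest_pred P))%:E)%E.
  rewrite /d /mu rrt_mean_cyc//; apply: dTV_window_count => [|h]; first by lia.
  exact: rrt_law.
have [|h1 h2] := @min_inv_bound mu (p / k%:R)
    (stein_error R n.-1 false k.-1 (forest_pred P)) mu0 pk.
  have ck : false && (n.-1 == (2 * k.-1).+1) = false by [].
  apply: le_trans (stein_error_le R (forest_pred P) ck) _.
  by rewrite natr1 prednK// -rrt_p_shape_prob -rrt_mean_cyc.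
by split=> hmu; apply: le_trans dle _; rewrite lee_fin; [exact: h1|exact: h2].
Qed.

Lemma dTV_ge0 (m1 m2 : probability nat R) : (0 <= dTV m1 m2)%E.
Proof.
apply: (@le_trans _ _ (`|m1 set0 - m2 set0|)%E); first exact: abse_ge0.
by apply: ereal_sup_ubound; exists set0.
Qed.

Lemma bst_dTV_le_inv n k P : (1 <= k < n)%N ->
  (dTV (distribution (bst_prob R n) (@bst_count n k P))
     (Po (bst_mean R n k P)) <= (24 / k%:R)%:E)%E.
Proof.
move=> kn; have [h1 h2] := bst_dTV_bound P kn; have [k0 _] := andP kn.
have p0 : 0 <= bst_p R k P by rewrite bst_p_shape_prob shape_prob_ge0.
have p1 : bst_p R k P <= 1 by rewrite bst_p_shape_prob shape_prob_le1.
have mu0 : 0 <= bst_mean R n k P by rewrite bst_mean_cyc// cyc_mean_ge0.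
have k1 : 0 <= k%:R^-1 :> R by rewrite invr_ge0.
have [nk|/eqP nk] := eqVneq n (2 * k + 1)%N.
  apply: le_trans (h2 nk) _; rewrite lee_fin ler_wpM2l//.
  by rewrite ler_piMl// expr_le1.
have [h3 h4] := h1 nk; have [mu1|mu1] := leP 1 (bst_mean R n k P).
  by apply: le_trans (h3 mu1) _; rewrite lee_fin ler_wpM2l// ler_piMl.
apply: le_trans (h4 mu1) _; rewrite lee_fin ler_wpM2l// mulrAC ler_piMl//.
by rewrite mulr_ile1// ltW.
Qed.

Lemma rrt_dTV_le_inv n k P : (1 <= k < n)%N ->
  (dTV (distribution (rrt_prob R n) (@rrt_count n k P))
     (Po (rrt_mean R n k P)) <= (24 / k%:R)%:E)%E.
Proof.
move=> kn; have [h3 h4] := rrt_dTV_bound P kn; have [k0 _] := andP kn.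
have p0 : 0 <= rrt_p R k P by rewrite rrt_p_shape_prob shape_prob_ge0.
have p1 : rrt_p R k P <= 1 by rewrite rrt_p_shape_prob shape_prob_le1.
have mu0 : 0 <= rrt_mean R n k P by rewrite rrt_mean_cyc// cyc_mean_ge0.
have k1 : 0 <= k%:R^-1 :> R by rewrite invr_ge0.
have [mu1|mu1] := leP 1 (rrt_mean R n k P).
  by apply: le_trans (h3 mu1) _; rewrite lee_fin ler_wpM2l// ler_piMl.
apply: le_trans (h4 mu1) _; rewrite lee_fin ler_wpM2l// mulrAC ler_piMl//.
by rewrite mulr_ile1// ltW.
Qed.

Lemma cvg_le_inv (k : nat -> nat) (d : nat -> \bar R) :
  (\forall n \near \oo, (1 <= k n < n)%N) -> k @ \oo --> \oo ->
  (forall n, (0 <= d n)%E) ->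
  (forall n, (1 <= k n < n)%N -> (d n <= (24 / (k n)%:R)%:E)%E) ->
  d n @[n --> \oo] --> 0%E.
Proof.
move=> kn koo d0 dle.
have inv_cvg : (fun m : nat => (m%:R : R)^-1) @ \oo --> (0 : R).
  by rewrite -cvg_shiftS; exact: cvg_harmonic.
have up : (24 / (k n)%:R : R)%:E @[n --> \oo] --> 0%E.
  rewrite (_ : 0%E = (24 * 0 : R)%:E); last by rewrite mulr0.
  apply: cvg_EFin; first by near=> n.
  apply: cvgM; first exact: cvg_cst.
  exact: (@cvg_comp _ _ _ k (fun m => (m%:R : R)^-1) _ _ _ koo inv_cvg).
apply: (squeeze_cvge _ (cvg_cst 0%E) up).
near=> n; rewrite d0 dle//; near: n; exact: kn.
Unshelve. all: end_near. Qed.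

End Bounds.

Local Open Scope classical_set_scope.
Local Open Scope ring_scope.

Theorem theorem1p9 (R : realType) :
  [/\
      (forall (n k : nat) (P : set (bintree unit)), (1 <= k < n)%N ->
        ('E_(bst_prob R n)[fun s => (bst_count k P s)%:R] =
         (2 * (n%:R + 1) * bst_p R k P / ((k%:R + 1) * (k%:R + 2)))%:E)%E) /\
      (forall (n k : nat) (P : set (otree unit)), (1 <= k < n)%N ->
        ('E_(rrt_prob R n)[fun f => (rrt_count k P f)%:R] =
         (n%:R * rrt_p R k P / (k%:R * (k%:R + 1)))%:E)%E),
      (exists C : R, forall (n k : nat) (P : set (bintree unit)),
        (1 <= k < n)%N ->
        let p := bst_p R k P in
        let mu := bst_mean R n k P in
        let d := dTV (distribution (bst_prob R n) (@bst_count n k P)) (Po mu) in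
        (n <> (2 * k + 1)%N ->
          [/\ (d = (2^-1)%:E * \sum_(0 <= l <oo)
                 `|bst_prob R n [set s | bst_count k P s = l]
                   - (expR (- mu) * (mu ^+ l / l`!%:R))%:E|)%E,
              (1 <= mu -> (d <= (C * (p / k%:R))%:E)%E) &
              (mu < 1 -> (d <= (C * (p / k%:R * mu))%:E)%E)]) /\
        (n = (2 * k + 1)%N -> (d <= (C * (p ^+ 2 / k%:R))%:E)%E)),
      (exists C : R, forall (n k : nat) (P : set (otree unit)),
        (1 <= k < n)%N ->
        let p := rrt_p R k P in
        let mu := rrt_mean R n k P in
        let d := dTV (distribution (rrt_prob R n) (@rrt_count n k P)) (Po mu) in
        [/\ (d = (2^-1)%:E * \sum_(0 <= l <oo)
               `|rrt_prob R n [set f | rrt_count k P f = l]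
                 - (expR (- mu) * (mu ^+ l / l`!%:R))%:E|)%E,
            (1 <= mu -> (d <= (C * (p / k%:R))%:E)%E) &
            (mu < 1 -> (d <= (C * (p / k%:R * mu))%:E)%E)]) &
      (forall (k : nat -> nat) (P : nat -> set (bintree unit)),
        (\forall n \near \oo, (1 <= k n < n)%N) -> k @ \oo --> \oo ->
        dTV (distribution (bst_prob R n) (@bst_count n (k n) (P n)))
          (Po (bst_mean R n (k n) (P n))) @[n --> \oo] --> 0%E) /\
      (forall (k : nat -> nat) (P : nat -> set (otree unit)),
        (\forall n \near \oo, (1 <= k n < n)%N) -> k @ \oo --> \oo ->
        dTV (distribution (rrt_prob R n) (@rrt_count n (k n) (P n)))
          (Po (rrt_mean R n (k n) (P n))) @[n --> \oo] --> 0%E)].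
Proof.
split.
- split=> n k P kn.
    rewrite bst_expectation// /cyc_mean /window_prob -bst_p_shape_prob.
    congr (_%:E); rewrite (_ : (nat_of_bool true)%:R = 1 :> R)// -(natr1 n); field.
    by rewrite -(natrD _ k 1) -(natrD _ k 2) !pnatr_eq0 !addnS.
  rewrite rrt_expectation// /cyc_mean /window_prob -rrt_p_shape_prob.
  have [k0 ltkn] := andP kn; congr (_%:E).
  have -> : n.-1.+1 = n by lia.
  have kE : k%:R = k.-1%:R + 1 :> R by rewrite natr1 prednK.
  rewrite kE mulr0n; field.
  have k1 : 0 <= k.-1%:R :> R by [].
  by do ?[apply/andP; split]; rewrite gt_eqF//; lra.
- exists 24 => n k P kn p mu d; have [h1 h2] := bst_dTV_bound R P kn.
  split=> [nk|]; last exact: h2.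
  have [h3 h4] := h1 nk; split=> //.
  by apply: dTV_count_half_sum; rewrite /mu bst_mean_cyc// cyc_mean_ge0.
- exists 24 => n k P kn p mu d; have [h3 h4] := rrt_dTV_bound R P kn.
  split=> //.
  by apply: dTV_count_half_sum; rewrite /mu rrt_mean_cyc// cyc_mean_ge0.
- split=> k P kn koo; apply: (cvg_le_inv kn koo) => n.
  + exact: dTV_ge0.
  + exact: bst_dTV_le_inv.
  + exact: dTV_ge0.
  + exact: rrt_dTV_le_inv.
Qed.
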